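(* Let $q\ge 0$ be real and let $X=(x_i)$, $Y=(y_j)$ be finite alphabets of nonnegative real numbers with $\max\{1,q\}\,x_iy_j<1$ for all $i,j$. Let $Z_q(X,Y)$ be the constant normalizing the weights $Q_\mu(qX)Q_{\lambda/\mu}(X)P_\lambda(Y)$ over pairs of strict partitions $\mu\subseteq\lambda$, i.e. $$Z_q(X,Y)=\sum_{\mu\subseteq\lambda}Q_\mu(qX)\,Q_{\lambda/\mu}(X)\,P_\lambda(Y).$$ Then $$Z_q(X,Y)=\mathsf H(qX;Y)\,\mathsf H(X;Y)=\mathsf H(X+qX;Y),$$ and explicitly $$Z_q(X,Y)=\prod_{i,j}\frac{1+x_iy_j}{1-x_iy_j}\,\frac{1+qx_iy_j}{1-qx_iy_j}.$$
   Context: $\mathrm{SP}$ is the set of strict partitions (including the empty one); $\mu\subseteq\lambda$ means $\mu_i\le\lambda_i$ for all $i$ after appending zeros. For an alphabet $A$, $p_n(A)$ is the $n$-th power sum. $A+B$ denotes the union of alphabets, so $p_n(A+B)=p_n(A)+p_n(B)$, and $qX=(qx_i)$. Schur $Q$- and $P$-functions are the standard ones (Macdonald, Ch. III.8): with $\sum_{r\ge0}q_r(A)z^r=\prod_{a\in A}\frac{1+az}{1-az}$, one has $Q_{(r)}=q_r$, $Q_{(r,s)}=q_rq_s+2\sum_{i\ge1}(-1)^iq_{r+i}q_{s-i}$ for $r>s\ge0$, and $Q_\lambda$ is the Pfaffian of the skew-symmetric matrix with upper entries $Q_{(\lambda_i,\lambda_j)}$, $i<j$ (a zero part is appended to $\lambda$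 if its length is odd); $P_\lambda=2^{-\ell(\lambda)}Q_\lambda$. Skew $Q$-functions are determined by $Q_\lambda(A+B)=\sum_{\mu\subseteq\lambda}Q_{\lambda/\mu}(A)Q_\mu(B)$. $\mathsf H(A;B)=\exp\Big(2\sum_{n\ge1,\ n\text{ odd}}\frac{p_n(A)p_n(B)}{n}\Big)$; for finite alphabets this equals $\prod_{a\in A,b\in B}\frac{1+ab}{1-ab}$, and $\mathsf H(A;B)=\sum_{\lambda\in\mathrm{SP}}Q_\lambda(A)P_\lambda(B)$. *)

(* Defs.v *)
From HB Require Import structures.
From mathcomp Require Import all_boot all_order all_algebra all_fingroup.
From mathcomp Require Import all_classical all_reals all_analysis.
Set Implicit Arguments.
Unset Strict Implicit.
Unset Printing Implicit Defensive.
Import Order.TTheory GRing.Theory Num.Theory.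
Import numFieldNormedType.Exports.
Local Open Scope classical_set_scope.
Local Open Scope ring_scope.

(** Strict partitions, as strictly decreasing sequences of positive parts. *)

Definition SP : set (seq nat) :=
  [set la | sorted gtn la /\ all (leq 1) la].

Definition subpart (mu la : seq nat) : Prop :=
  forall i, (nth 0 mu i <= nth 0 la i)%N.

(** Finite alphabets are sequences; the union A + B is [A ++ B]. *)

Definition scale (R : realType) (q : R) (X : seq R) : seq R :=
  [seq q * x | x <- X].

Definition psum (R : realType) (n : nat) (A : seq R) : R :=
  \sum_(a <- A) a ^+ n.

(* The coefficient of z^r in \prod_a (1 + a z) / (1 - a z); cutting each
   1 / (1 - a z) after z^r does not affect this coefficient. *)
Definition qfun (R : realType) (r : nat) (A : seq R) : R :=
  (\prod_(a <- A) ((1 + a *: 'X) * \poly_(i < r.+1) a ^+ i))`_r.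

(* The sum stops at i = s because q_m = 0 for m < 0. *)
Definition Qtwo (R : realType) (r s : nat) (A : seq R) : R :=
  qfun r A * qfun s A +
  2 * \sum_(1 <= i < s.+1) (-1) ^+ i * qfun (r + i) A * qfun (s - i) A.

Lemma fst_ord_subproof m (i : 'I_m) : (i.*2 < m.*2)%N.
Proof. by rewrite ltn_double. Qed.

Lemma snd_ord_subproof m (i : 'I_m) : (i.*2.+1 < m.*2)%N.
Proof. by rewrite ltn_Sdouble. Qed.

Definition fst_ord m (i : 'I_m) : 'I_(m.*2) := Ordinal (fst_ord_subproof i).
Definition snd_ord m (i : 'I_m) : 'I_(m.*2) := Ordinal (snd_ord_subproof i).

(* The permutations that encode a perfect matching {s(0),s(1)}, {s(2),s(3)}, ...
   with each pair increasing and the pairs sorted by first element. *)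
Definition is_matching m (s : 'S_(m.*2)) : bool :=
  [forall i : 'I_m, s (fst_ord i) < s (snd_ord i)]%N &&
  [forall i : 'I_m, forall j : 'I_m,
     (i < j)%N ==> (s (fst_ord i) < s (fst_ord j))%N].

Definition pfaffian (R : comPzRingType) m (M : 'M[R]_(m.*2)) : R :=
  \sum_(s : 'S_(m.*2) | is_matching s)
    (-1) ^+ s * \prod_(i < m) M (s (fst_ord i)) (s (snd_ord i)).

(* When [size la] is odd, the default value of [nth] is the appended zero. *)
Definition Qmatrix (R : realType) (la : seq nat) (A : seq R) :
    'M[R]_((uphalf (size la)).*2) :=
  \matrix_(i, j)
    if (i < j)%N then Qtwo (nth 0 la i) (nth 0 la j) A
    else if (j < i)%N then - Qtwo (nth 0 la j) (nth 0 la i) A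
    else 0.

Definition schurQ (R : realType) (la : seq nat) (A : seq R) : R :=
  pfaffian (Qmatrix la A).

Definition schurP (R : realType) (la : seq nat) (A : seq R) : R :=
  2 ^- size la * schurQ la A.

(* The summation range is finite, so this is an ordinary finite sum. *)
Definition is_skewQ (R : realType) (f : seq nat -> seq nat -> seq R -> R) :
    Prop :=
  forall la, SP la -> forall A B : seq R,
    schurQ la (A ++ B) =
    \sum_(mu \in SP `&` [set mu | subpart mu la]) f la mu A * schurQ mu B.

(* [skewQ la mu] is Q_{la/mu}. As the functions [schurQ mu], [SP mu], are
   linearly independent, [is_skewQ] determines it for [subpart mu la]; the
   value is arbitrary, and never used, otherwise. *)
Definition skewQ (R : realType) : seq nat -> seq nat -> seq R -> R :=
  xget (fun _ _ _ => 0) [set f | is_skewQ f].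

Definition H (R : realType) (A B : seq R) : R :=
  expR (2 * limn (fun N : nat =>
    \sum_(1 <= n < N | odd n) psum n A * psum n B / n%:R)).

(* The weights are nonnegative for nonnegative q, X, Y, so the supremum of the
   finite partial sums computed by [esum] is the sum of the series. *)
Definition Z (R : realType) (q : R) (X Y : seq R) : \bar R :=
  \esum_(p in [set p : seq nat * seq nat |
                 [/\ SP p.1, SP p.2 & subpart p.1 p.2]])
    (schurQ p.1 (scale q X) * skewQ p.2 p.1 X * schurP p.2 Y)%:E.

(* Main.v *)
Require Import Defs.
From mathcomp Require Import all_boot all_order all_algebra all_fingroup.
From mathcomp Require Import all_classical all_reals all_analysis.
From mathcomp Require Import ring lra zify.
Import Order.TTheory GRing.Theory Num.Theory.
Import numFieldNormedType.Exports.
Set Implicit Arguments.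
Unset Strict Implicit.
Unset Printing Implicit Defensive.
Local Open Scope ring_scope.

(** Summed over mu first, the weights Q_mu(qX) Q_(la/mu)(X) P_la(Y) collapse, by
    the property that defines skew Q-functions, to Q_la(X + qX) P_la(Y)
    ([Z_cauchy]).  All terms are nonnegative, so this rearrangement is harmless,
    and the theorem becomes the Cauchy identity for Q-functions
    ([cauchy_identity]) together with the evaluation of H as a product
    ([H_cauchy_factor]), which rests on the power series of ln ((1 + t) / (1 - t)).
    Both equalities with H then follow because the product is multiplicative in
    the alphabet.

    Everything about Q-functions rests on the branching rule [schurQ_branch],
    which removes one variable x from Q_la.  Adding x to an alphabet multiplies
    the generating function of the q_r by (1 + x z) / (1 - x z); in the Pfaffian
    this replaces each row index r by a combination of the indices up to r
    ([schurQ_shift]).  Since Pfaffians are multilinear and alternating, the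
    result can be expanded, and carrying this out from the largest column to the
    smallest gives a sum over the partitions mu for which la / mu is a horizontal
    strip, weighted by a six-vertex model ([strip_weight]).  Iterated branching
    yields skew Q-functions with nonnegative values; by the linear independence
    of Q-functions ([schurQ_free]) they are the ones of the definition on all
    pairs of nested partitions ([skewQE]).

    The six-vertex weights satisfy a Yang-Baxter equation
    ([exchange_relations]), which is checked on one column at a time.  Its
    consequence for infinitely many columns is the skew Cauchy identity in one
    pair of variables ([has_sum_up]).  Adding the variables of one alphabet one
    at a time turns it into the Pieri rule ([pieri]), and adding those of the
    other alphabet turns this into the Cauchy identity. *)

(** * Pfaffians of lists *)

Section ListPfaffian.
Variables (R : comPzRingType) (V : eqType) (b : V -> V -> R).

(** Contraction of [a] with each entry of a list in turn: the antiderivation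
    that expands a Pfaffian along its first row.  Taking the functional [g] as
    an argument lets the sign of each term come from structural recursion. *)
Fixpoint contract (a : V) (g : seq V -> R) (s : seq V) : R :=
  if s is c :: s' then b a c * g s' - contract a (fun t => g (c :: t)) s'
  else 0.

(** The fuel [n] bounds the number of contractions; it is never exhausted when
    it is at least half the length of the list.  Lists of odd length get 0. *)
Fixpoint pf_rec (n : nat) (s : seq V) : R :=
  match n, s with
  | _, [::] => 1
  | 0%N, _ => 0
  | n'.+1, a :: s' => contract a (pf_rec n') s'
  end.

Definition pf (s : seq V) : R := pf_rec (size s) s.

Lemma eq_contract a g h s :
  (forall t, (size t).+1 = size s -> g t = h t) ->
  contract a g s = contract a h s.
Proof.
elim: s g h => //= c s IH g h gh; rewrite gh // (IH _ (fun t => h (c :: t))) //.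
by move=> t st; apply: gh; rewrite /= st.
Qed.

Lemma contractN a g s : contract a (fun t => - g t) s = - contract a g s.
Proof. by elim: s g => [|c s IH] g /=; rewrite ?oppr0 // IH; ring. Qed.

Lemma contractB a g h s :
  contract a (fun t => g t - h t) s = contract a g s - contract a h s.
Proof. by elim: s g h => [|c s IH] g h /=; rewrite ?subr0 // IH; ring. Qed.

Lemma contractZ a k g s :
  contract a (fun t => k * g t) s = k * contract a g s.
Proof. by elim: s g => [|c s IH] g /=; rewrite ?mulr0 // IH; ring. Qed.

Lemma pf_rec_fuel n n' s :
  (size s <= n)%N -> (size s <= n')%N -> pf_rec n s = pf_rec n' s.
Proof.
elim: n n' s => [|n IH] [|n'] [|a s] //= sn sn'.
by apply: eq_contract => t st; apply: IH; lia.
Qed.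

Lemma pf_cons a s : pf (a :: s) = contract a pf s.
Proof.
rewrite {1}/pf /=; apply: eq_contract => t st.
by apply: pf_rec_fuel => //; rewrite -st.
Qed.

Definition alternating (g : seq V -> R) : Prop :=
  forall s1 a c s2, g (s1 ++ a :: c :: s2) = - g (s1 ++ c :: a :: s2).

Lemma alternating_contract a g : alternating g -> alternating (contract a g).
Proof.
move=> ag s1; elim: s1 g ag => [|d s1 IH] g ag c e s2 /=.
  rewrite (@eq_contract _ _ (fun t => - g (e :: c :: t))) ?contractN; first ring.
  by move=> t _; apply: (ag [::]).
rewrite ag IH; first ring.
by move=> t1 u v t2; apply: (ag (d :: t1)).
Qed.

(** Contractions generate an exterior algebra; this is what makes the
    Pfaffian alternating in its first two entries. *)
Lemma contract_anticomm a c g s :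
  contract a (contract c g) s = - contract c (contract a g) s.
Proof.
elim: s g => [|d s IH] g /=; first by rewrite oppr0.
by rewrite !contractB !contractZ IH; ring.
Qed.

Hypothesis b_anti : forall v w, b v w = - b w v.

(** Away from the front, alternation is inherited through [contract]; at the
    front it is the anticommutation of contractions, the term [b a c] being
    antisymmetric by itself. *)
Lemma alternating_pf_rec n : alternating (pf_rec n).
Proof.
elim: n => [|n IH] s1 a c s2; first by case: s1 => [|d s1] /=; rewrite oppr0.
case: s1 => [|d s1] /=; last exact: alternating_contract.
rewrite [b c a]b_anti; case: n {IH} => [|n] /=.
  have z d : contract d (fun=> 0) s2 = 0.
    by rewrite (@eq_contract _ _ (fun t => 0 * 0)) ?contractZ ?mul0r // => *; ring.
  by rewrite !z; ring.
by rewrite (contract_anticomm a c); ring.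
Qed.

Lemma alternating_pf : alternating pf.
Proof.
by move=> s1 a c s2; rewrite /pf alternating_pf_rec !size_cat.
Qed.

Lemma pf_move s1 v s2 :
  pf (s1 ++ v :: s2) = (-1) ^+ size s1 * pf (v :: s1 ++ s2).
Proof.
elim/last_ind: s1 s2 => [|s1 u IH] s2; first by rewrite mul1r.
by rewrite !cat_rcons alternating_pf IH size_rcons exprS; ring.
Qed.

(** Linearity is only required at the level of the form, so that entries may be
    formal objects without a vector space structure of their own. *)
Lemma pf_linear s1 v s2 (c1 c2 : R) w1 w2 :
  (forall u, b v u = c1 * b w1 u + c2 * b w2 u) ->
  pf (s1 ++ v :: s2) = c1 * pf (s1 ++ w1 :: s2) + c2 * pf (s1 ++ w2 :: s2).
Proof.
move=> bE; rewrite !(pf_move _ _ s2).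
have -> : pf (v :: s1 ++ s2) = c1 * pf (w1 :: s1 ++ s2) + c2 * pf (w2 :: s1 ++ s2).
  rewrite !pf_cons; elim: (s1 ++ s2) pf => [|d s IH] g /=; first by ring.
  by rewrite IH bE; ring.
by ring.
Qed.

Lemma contract_eq0 a g s : {in s, forall w, b a w = 0} -> contract a g s = 0.
Proof.
elim: s g => //= d s IH g ba; rewrite ba ?mem_head // IH; first by ring.
by move=> w ws; rewrite ba // inE ws orbT.
Qed.

Lemma contract_last a g s c :
  {in s, forall w, b a w = 0} ->
  contract a g (rcons s c) = (-1) ^+ size s * b a c * g s.
Proof.
elim: s g => [|d s IH] g ba /=; first by ring.
rewrite ba ?mem_head // IH ?exprS; first by ring.
by move=> w ws; rewrite ba // inE ws orbT.
Qed.

End ListPfaffian.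

Lemma eq_pf (R : comPzRingType) (V W : eqType) (b : V -> V -> R)
    (b' : W -> W -> R) (h : V -> W) (s : seq V) :
  {in s &, forall v w, b v w = b' (h v) (h w)} -> pf b s = pf b' (map h s).
Proof.
rewrite /pf size_map; move: (size s) => n; elim: n s => [|n IH] [|a s] //= bE.
have {}IH t : {subset t <= s} -> pf_rec b n t = pf_rec b' n (map h t).
  move=> ts; apply: IH => v w vt wt.
  by apply: bE; rewrite inE ts ?orbT.
have {}bE : {in s, forall w, b a w = b' (h a) (h w)}.
  by move=> w ws; apply: bE; rewrite inE ?eqxx // ws orbT.
elim: s (pf_rec b n) (pf_rec b' n) IH bE => //= c s IHs g g' gE bE.
rewrite bE ?mem_head // gE; last by move=> x xs; rewrite inE xs orbT.
congr (_ - _); apply: IHs => [t ts | w ws]; last by apply: bE; rewrite inE ws orbT.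
apply: gE => x; rewrite !inE => /orP[->//|/ts->]; exact: orbT.
Qed.

(** * First-row expansion of the Pfaffian *)

Lemma lift_perm_surj n (i : 'I_n.+1) (s : 'S_n.+1) :
  exists t : 'S_n, s = lift_perm i (s i) t.
Proof.
pose u k := odflt k (unlift (s i) (s (lift i k))).
have uK k : lift (s i) (u k) = s (lift i k).
  rewrite /u; have := neq_lift i k.
  by rewrite -(can_eq (permK s)) => /unlift_some[] ? ? ->.
have u_inj : injective u.
  by move=> k l /(congr1 (lift (s i))); rewrite !uK => /perm_inj/lift_inj.
exists (perm u_inj); apply/permP => k.
case: (unliftP i k) => [k'|] ->; last by rewrite lift_perm_id.
by rewrite lift_perm_lift permE uK.
Qed.

(** A perfect matching of a set of m.+1 pairs is the partner of the least
    element together with a matching of the remaining 2m elements; these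
    remaining elements are renumbered increasingly by the two lifts. *)
Definition add_pair m (p : 'I_m.*2.+1 * 'S_(m.*2)) : 'S_(m.+1.*2) :=
  lift_perm (ord0 : 'I_m.*2.+2) ord0 (lift_perm ord0 p.1 p.2).

Lemma add_pair_inj m : injective (@add_pair m).
Proof.
move=> [j s] [k t] /= e.
have e1 x : lift_perm ord0 j s x = lift_perm ord0 k t x.
  have /permP/(_ (lift ord0 x)) := e.
  by rewrite /add_pair !lift_perm_lift => /lift_inj.
have ejk : j = k by have := e1 ord0; rewrite !lift_perm_id.
rewrite -ejk in e1; rewrite -ejk; congr pair; apply/permP => x.
by have := e1 (lift ord0 x); rewrite !lift_perm_lift => /lift_inj.
Qed.

Lemma add_pair_fst0 m (p : 'I_m.*2.+1 * 'S_(m.*2)) :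
  add_pair p (fst_ord ord0) = ord0.
Proof.
have -> : fst_ord ord0 = ord0 :> 'I_(m.+1.*2) by apply: val_inj.
exact: lift_perm_id.
Qed.

Lemma add_pair_snd0 m (p : 'I_m.*2.+1 * 'S_(m.*2)) :
  add_pair p (snd_ord ord0) = lift (ord0 : 'I_m.*2.+2) p.1.
Proof.
have -> : snd_ord ord0 = lift (ord0 : 'I_m.*2.+2) ord0 :> 'I_(m.+1.*2).
  by apply: val_inj.
by rewrite /add_pair lift_perm_lift lift_perm_id.
Qed.

Lemma add_pair_fstS m (p : 'I_m.*2.+1 * 'S_(m.*2)) (i : 'I_m) :
  add_pair p (fst_ord (lift ord0 i)) =
    lift (ord0 : 'I_m.*2.+2) (lift p.1 (p.2 (fst_ord i))).
Proof.
have -> : fst_ord (lift ord0 i) =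
    lift (ord0 : 'I_m.*2.+2) (lift ord0 (fst_ord i)) :> 'I_(m.+1.*2).
  by apply: val_inj.
by rewrite /add_pair !lift_perm_lift.
Qed.

Lemma add_pair_sndS m (p : 'I_m.*2.+1 * 'S_(m.*2)) (i : 'I_m) :
  add_pair p (snd_ord (lift ord0 i)) =
    lift (ord0 : 'I_m.*2.+2) (lift p.1 (p.2 (snd_ord i))).
Proof.
have -> : snd_ord (lift ord0 i) =
    lift (ord0 : 'I_m.*2.+2) (lift ord0 (snd_ord i)) :> 'I_(m.+1.*2).
  by apply: val_inj.
by rewrite /add_pair !lift_perm_lift.
Qed.

Lemma ltn_lift n (h : 'I_n.+1) (i j : 'I_n) : (lift h i < lift h j)%N = (i < j)%N.
Proof. by rewrite !ltnNge leq_bump2. Qed.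

Lemma is_matching_add_pair m (p : 'I_m.*2.+1 * 'S_(m.*2)) :
  is_matching (add_pair p) = is_matching p.2.
Proof.
apply/andP/andP => [[/forallP h1 /forallP h2]|[/forallP h1 /forallP h2]].
  split; apply/forallP => i.
    have := h1 (lift ord0 i).
    by rewrite add_pair_fstS add_pair_sndS !ltn_lift.
  apply/forallP => j; have /forallP := h2 (lift ord0 i) => /(_ (lift ord0 j)).
  by rewrite !add_pair_fstS !ltn_lift.
split; apply/forallP => i.
  case: (unliftP ord0 i) => [i'|] ->; last by rewrite add_pair_fst0 add_pair_snd0.
  by rewrite add_pair_fstS add_pair_sndS !ltn_lift.
apply/forallP => j.
case: (unliftP ord0 i) => [i'|] ->; case: (unliftP ord0 j) => [j'|] ->;
  rewrite ?add_pair_fst0 ?add_pair_fstS ?ltn_lift //.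
by have /forallP := h2 i' => /(_ j').
Qed.

(** The first elements of the pairs are sorted, and each is the smaller one of
    its pair, so the overall minimum opens the first pair. *)
Lemma matching_first m (s : 'S_(m.+1.*2)) : is_matching s -> s ord0 = ord0.
Proof.
case/andP=> /forallP h1 /forallP h2.
have h0 i : (s (fst_ord ord0) <= s (fst_ord i))%N.
  case: (unliftP ord0 i) => [i'|] -> //.
  by have /forallP/(_ (lift ord0 i')) := h2 ord0; move/implyP/(_ isT)/ltnW.
have h3 k : (s (fst_ord ord0) <= s k)%N.
  have lt : (k./2 < m.+1)%N by rewrite ltn_half_double.
  have [ok|ek] := boolP (odd k).
    have -> : k = snd_ord (Ordinal lt).
      by apply: val_inj; rewrite /= -[LHS]odd_double_half ok.
    exact: leq_trans (h0 _) (ltnW (h1 _)).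
  have -> : k = fst_ord (Ordinal lt).
    by apply: val_inj; rewrite /= -[LHS]odd_double_half (negbTE ek).
  exact: h0.
have -> : ord0 = fst_ord ord0 :> 'I_(m.+1.*2) by apply: val_inj.
apply: val_inj => /=; apply/eqP; rewrite -leqn0.
by have := h3 ((s^-1)%g ord0); rewrite permKV.
Qed.

(** The arc from 0 to j+1 crosses a number of other arcs that is congruent to j
    modulo 2, whence the sign. *)
Lemma pfaffian_expand (R : comPzRingType) m (M : 'M[R]_(m.+1.*2)) :
  pfaffian M = \sum_(j < m.*2.+1) (-1) ^+ j *
    M (ord0 : 'I_m.*2.+2) (lift (ord0 : 'I_m.*2.+2) j) *
    pfaffian (\matrix_(i, k) M (lift (ord0 : 'I_m.*2.+2) (lift j i))
                               (lift (ord0 : 'I_m.*2.+2) (lift j k))).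
Proof.
rewrite /pfaffian; under [RHS]eq_bigr do rewrite big_distrr /=.
rewrite pair_big_dep /=.
rewrite (eq_bigl (mem (@add_pair m @: [set p | is_matching p.2]))); last first.
  move=> s /=; apply/idP/imsetP => [ms|[p]]; last first.
    by rewrite inE => mp ->; rewrite is_matching_add_pair.
  have [t est] := lift_perm_surj ord0 (s : 'S_m.*2.+2).
  have [t' ett] := lift_perm_surj ord0 t.
  have es : s = add_pair (t ord0, t').
    by rewrite /add_pair /= -ett {1}est (matching_first ms).
  by exists (t ord0, t') => //; rewrite inE -is_matching_add_pair -es.
rewrite big_imset; last by move=> p p' _ _; apply: add_pair_inj.
apply: eq_big => [p|p _]; first by rewrite inE.
rewrite big_ord_recl add_pair_fst0 add_pair_snd0.
under [in RHS]eq_bigr do rewrite mxE -add_pair_fstS -add_pair_sndS.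
have -> : (-1) ^+ add_pair p = (-1) ^+ p.1 * (-1) ^+ p.2 :> R.
  by rewrite /add_pair !odd_lift_perm /= signr_addb signr_odd.
by rewrite mulrACA !mulrA.
Qed.

Lemma contractE (R : comPzRingType) (V : eqType) (b : V -> V -> R) x0 a g s :
  contract b a g s =
  \sum_(j < size s) (-1) ^+ j * b a (nth x0 s j) * g (take j s ++ drop j.+1 s).
Proof.
elim: s g => [|c s IH] g /=; first by rewrite big_ord0.
rewrite big_ord_recl /= drop0 IH expr0 mul1r -sumrN; congr (_ + _).
by apply: eq_bigr => i _; rewrite /bump /= exprS; ring.
Qed.

(** Only entries above the diagonal enter the sum over matchings, hence the
    restriction to [i < j]. *)
Lemma pfaffianE (R : comPzRingType) (V : eqType) (b : V -> V -> R) (x0 : V) m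
    (M : 'M[R]_(m.*2)) (s : seq V) :
  size s = m.*2 ->
  (forall i j : 'I_(m.*2), (i < j)%N -> M i j = b (nth x0 s i) (nth x0 s j)) ->
  pfaffian M = pf b s.
Proof.
elim: m M s => [|m IH] M [|a s] // => [_ _|ss Mb].
  rewrite /pfaffian /pf /= (big_pred1 1%g) => [|p].
    by rewrite odd_perm1 big_ord0 mulr1.
  have -> : p = 1%g by apply/permP => -[].
  rewrite /= eqxx; apply/eqP; rewrite eqb_id.
  by apply/andP; split; apply/forallP => -[].
have {}ss : size s = m.*2.+1 by case: ss.
rewrite pfaffian_expand pf_cons (contractE _ x0) ss.
apply: eq_bigr => j _; rewrite Mb; last by rewrite /= /bump.
congr (_ * _).
have js : (j <= size s)%N by rewrite ss ltnW.
have szt : size (take j s) = j by rewrite size_takel.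
apply: (IH _ (take j s ++ drop j.+1 s)) => [|i k ik].
  rewrite size_cat szt size_drop ss; move: (nat_of_ord j) (ltn_ord j) => k; lia.
have nthE (l : 'I_m.*2) :
    nth x0 (take j s ++ drop j.+1 s) l = nth x0 (a :: s) (lift ord0 (lift j l)).
  rewrite nth_cat szt /= /bump /= add0n; case: leqP => jl /=.
    by rewrite nth_drop; congr nth; lia.
  by rewrite nth_take.
by rewrite mxE Mb ?ltn_lift // !nthE.
Qed.

(** * The functions q_r and the two-row functions *)

(** Congruence modulo 'X^n, which replaces equality of power series: every
    coefficient of interest lies below some [n]. *)
Definition eqmod_poly (R : nzRingType) (n : nat) (p q : {poly R}) : Prop :=
  forall i, (i < n)%N -> p`_i = q`_i.

Lemma eqmod_polyM (R : nzRingType) n (p p' q q' : {poly R}) :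
  eqmod_poly n p p' -> eqmod_poly n q q' -> eqmod_poly n (p * q) (p' * q').
Proof.
move=> pp qq i ltin; rewrite !coefM; apply: eq_bigr => j _.
rewrite pp ?qq //; first exact: leq_ltn_trans (leq_subr _ _) ltin.
exact: leq_trans (ltn_ord j) ltin.
Qed.

Lemma eqmod_poly_cancel (R : nzRingType) n (u p q : {poly R}) :
  u`_0 = 1 -> eqmod_poly n (u * p) (u * q) -> eqmod_poly n p q.
Proof.
move=> u0 upq i; elim/ltn_ind: i => i IH ltin.
have := upq i ltin; rewrite !coefM !big_ord_recl /= u0 subn0 !mul1r.
under eq_bigr => j _.
  rewrite IH; [over | |]; have := ltn_ord j; rewrite /bump /=; lia.
exact: addIr.
Qed.

Section QFunctions.
Variable R : realType.
Implicit Types (x : R) (A B : seq R).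

Lemma geom_polyK n x :
  eqmod_poly n ((1 - x *: 'X) * \poly_(i < n) x ^+ i) 1.
Proof.
move=> i ltin; rewrite mulrBl mul1r -scalerAl coefB coefZ coefXM coef1 !coef_poly ltin.
case: i ltin => [|i] ltin /=; first by rewrite mulr0 subr0.
by rewrite (ltnW ltin) exprS subrr.
Qed.

(** Truncating the geometric series at any higher order leaves the coefficient
    unchanged, so all [qfun r A] with [r < n] come from one polynomial. *)
Lemma qfunE n r A : (r < n)%N ->
  (\prod_(a <- A) ((1 + a *: 'X) * \poly_(i < n) a ^+ i))`_r = qfun r A.
Proof.
move=> ltrn; suff: eqmod_poly r.+1
    (\prod_(a <- A) ((1 + a *: 'X) * \poly_(i < n) a ^+ i))
    (\prod_(a <- A) ((1 + a *: 'X) * \poly_(i < r.+1) a ^+ i)) by exact.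
elim: A => [|a A IH]; first by rewrite !big_nil.
rewrite !big_cons; apply: eqmod_polyM => //; apply: eqmod_polyM => // i ltir.
by rewrite !coef_poly ltir (leq_trans ltir).
Qed.

Lemma qfun_nil r : qfun r ([::] : seq R) = (r == 0)%N%:R.
Proof. by rewrite /qfun big_nil coef1. Qed.

(** The generating function of the q_r gets multiplied by
    (1 + x z) / (1 - x z) when x joins the alphabet. *)
Lemma qfun_cons_poly n x A :
  eqmod_poly n ((1 - x *: 'X) * \poly_(i < n) qfun i (x :: A))
               ((1 + x *: 'X) * \poly_(i < n) qfun i A).
Proof.
have E (C : seq R) : eqmod_poly n (\poly_(i < n) qfun i C)
    (\prod_(a <- C) ((1 + a *: 'X) * \poly_(i < n) a ^+ i)).
  by move=> i ltin; rewrite coef_poly ltin qfunE.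
move=> i ltin; rewrite (eqmod_polyM (fun _ _ => erefl) (E (x :: A))) //.
rewrite (eqmod_polyM (fun _ _ => erefl) (E A)) // big_cons.
set g := \poly_(j < n) x ^+ j; set P := \prod_(a <- A) _.
have -> : (1 - x *: 'X) * ((1 + x *: 'X) * g * P) =
  (1 + x *: 'X) * P * ((1 - x *: 'X) * g) by ring.
by rewrite (eqmod_polyM (fun _ _ => erefl) (@geom_polyK n x)) // mulr1.
Qed.

Lemma qfun0 A : qfun 0 A = 1.
Proof.
elim: A => [|x A IH]; first by rewrite qfun_nil.
have := @qfun_cons_poly 1 x A 0%N isT.
by rewrite !mulrDl mulNr -!scalerAl coefB coefD !coefZ !coefXM !mul1r
  !coef_poly /= !mulr0 subr0 addr0 IH.
Qed.

Lemma qfun_cons r x A :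
  qfun r.+1 (x :: A) = x * qfun r (x :: A) + qfun r.+1 A + x * qfun r A.
Proof.
have := @qfun_cons_poly r.+2 x A r.+1 (ltnSn _).
rewrite !mulrDl mulNr -!scalerAl coefB coefD !coefZ !coefXM !mul1r !coef_poly.
by rewrite ltnSn (ltnW (ltnSn _)) /= => /eqP; rewrite subr_eq => /eqP ->; ring.
Qed.

(** The generating function F of the q_r satisfies F(-z) F(z) = 1. *)
Lemma qfun_alt_poly n A :
  eqmod_poly n ((\poly_(i < n) ((-1) ^+ i * qfun i A)) * \poly_(i < n) qfun i A) 1.
Proof.
elim: A => [|x A IH].
  have E1 : eqmod_poly n (\poly_(i < n) qfun i ([::] : seq R)) 1.
    by move=> i ltin; rewrite coef_poly ltin qfun_nil coef1.
  have E2 : eqmod_poly n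
      (\poly_(i < n) ((-1) ^+ i * qfun i ([::] : seq R))) 1.
    move=> i ltin; rewrite coef_poly ltin qfun_nil coef1.
    by case: i {ltin} => [|i] /=; rewrite ?mul1r ?mulr0.
  by move=> i ltin; rewrite (eqmod_polyM E2 E1) // mulr1.
apply: (@eqmod_poly_cancel _ _ ((1 + x *: 'X) * (1 - x *: 'X))).
  by rewrite coef0M coefD coefB coefZ coefX coef1 /= mulr0 addr0 subr0 mulr1.
have alt : eqmod_poly n ((1 + x *: 'X) * \poly_(i < n) ((-1) ^+ i * qfun i (x :: A)))
    ((1 - x *: 'X) * \poly_(i < n) ((-1) ^+ i * qfun i A)).
  move=> [|i] ltin;
    rewrite !mulrDl !mulNr -!scalerAl coefB coefD !coefZ !coefXM !mul1r !coef_poly ltin /=.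
    by rewrite !qfun0; ring.
  by rewrite (ltnW ltin) qfun_cons !exprS; ring.
move=> i ltin; rewrite mulrACA (eqmod_polyM alt (@qfun_cons_poly n x A)) //.
rewrite mulrACA [(1 - _) * _]mulrC.
by rewrite (eqmod_polyM (fun _ _ => erefl) IH).
Qed.

Lemma qfun_alt n A :
  \sum_(i < n.+1) (-1) ^+ i * qfun i A * qfun (n - i) A = (n == 0)%N%:R.
Proof.
have := @qfun_alt_poly n.+1 A n (ltnSn n); rewrite coef1 => <-.
rewrite coefM; apply: eq_bigr => i _; rewrite !coef_poly ltn_ord.
by rewrite ltnS leq_subr.
Qed.

Lemma Qtwo0 r A : Qtwo r 0 A = qfun r A.
Proof. by rewrite /Qtwo big_geq // qfun0; ring. Qed.

(** Coefficient form of (z + w) Q(z, w) = (z - w) F(z) F(w), which determines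
    the two-row functions from those with [s = 0]. *)
Lemma QtwoS r s A :
  Qtwo r s.+1 A = qfun r A * qfun s.+1 A - qfun r.+1 A * qfun s A - Qtwo r.+1 s A.
Proof.
rewrite /Qtwo big_nat_recl // subSS subn0 addn1 expr1.
under eq_bigr do rewrite exprS addnS subSS mulN1r !mulNr -addSn.
by rewrite sumrN; ring.
Qed.

(** By [QtwoS] the symmetrized function only changes sign along an
    antidiagonal, so it can be computed at its end, where it is the
    coefficient of F(-z) F(z). *)
Lemma Qtwo_sym r s A :
  Qtwo r s A + Qtwo s r A = 2 * ((r == 0) && (s == 0))%N%:R.
Proof.
have red t u : Qtwo u t A + Qtwo t u A =
    (-1) ^+ t * (Qtwo (u + t) 0 A + Qtwo 0 (u + t) A).
  elim: t u => [|t IH] u; first by rewrite addn0 mul1r.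
  by rewrite addnS -addSn exprS mulN1r mulNr -IH QtwoS; have := QtwoS t u A; lra.
have Q0 n : Qtwo n 0 A + Qtwo 0 n A = 2 * (n == 0)%N%:R.
  rewrite Qtwo0 /Qtwo -(qfun_alt n A) big_ord_recl /= subn0 qfun0.
  rewrite big_add1 big_mkord /=; under [in RHS]eq_bigr do rewrite /bump /=.
  by rewrite expr0; ring.
rewrite red Q0 addn_eq0; case: (s =P 0%N) => [->|_]; first by rewrite expr0 mul1r.
by rewrite andbF !mulr0.
Qed.

(** Coefficient form, for positive exponents, of
    (1 - x z) (1 - x w) Q_(x,A)(z, w) = (1 + x z) (1 + x w) Q_A(z, w); the
    induction propagates it along antidiagonals by [QtwoS]. *)
Lemma Qtwo_cons r s x A :
  Qtwo r.+1 s.+1 (x :: A) - x * Qtwo r s.+1 (x :: A)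
    - x * Qtwo r.+1 s (x :: A) + x ^+ 2 * Qtwo r s (x :: A) =
  Qtwo r.+1 s.+1 A + x * Qtwo r s.+1 A
    + x * Qtwo r.+1 s A + x ^+ 2 * Qtwo r s A.
Proof.
elim: s r => [|s IH] r.
  rewrite !QtwoS !Qtwo0 !qfun0 !qfun_cons !qfun0; ring.
have := IH r.+1; rewrite !(QtwoS _ s.+1) !(QtwoS _ s) !qfun_cons; lra.
Qed.

End QFunctions.

(** * Adding a variable inside the Pfaffian *)

(** The entries of the Pfaffian, as a form on formal row indices.  [None] is the
    row appended when the length is odd.  It is kept apart from the index 0:
    both pair with [Some r] to q_r when r is positive, but the form must
    vanish on (0, 0) to be antisymmetric, while 0 and [None] pair to q_0 = 1. *)
Definition pair_form (R : realType) (A : seq R) (i j : option nat) : R :=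
  match i, j with
  | Some r, Some s => Qtwo r s A - ((r == 0) && (s == 0))%N%:R
  | Some r, None => qfun r A
  | None, Some s => - qfun s A
  | None, None => 0
  end.

Lemma pair_form_anti (R : realType) (A : seq R) i j :
  pair_form A i j = - pair_form A j i.
Proof.
case: i j => [r|] [s|] //=; rewrite ?opprK ?oppr0 //.
by have := Qtwo_sym r s A; rewrite andbC; lra.
Qed.

Lemma schurQE (R : realType) (la : seq nat) (A : seq R) :
  all (leq 1) la ->
  schurQ la A = pf (pair_form A) (map Some la ++ nseq (odd (size la)) None).
Proof.
move=> /allP la_gt0.
have sz : size (map Some la ++ nseq (odd (size la)) None) = (uphalf (size la)).*2.
  by rewrite size_cat size_map size_nseq; have := odd_double_half (size la);
    rewrite uphalf_half; case: (odd _) => /=; lia.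
apply: (@pfaffianE _ _ (pair_form A) None _ _ _ sz) => i j ltij; rewrite mxE ltij.
have lti : (i < size la)%N.
  have := ltn_ord j; rewrite -{2}sz size_cat size_map size_nseq.
  by move: ltij; case: (odd _) => /=; lia.
rewrite !nth_cat !size_map lti (nth_map 0%N) //=.
have li0 : (nth 0 la i == 0)%N = false.
  by have := la_gt0 _ (mem_nth 0%N lti); case: (nth _ _ _).
case: ltnP => [ltj|gej]; first by rewrite (nth_map 0%N) //= li0 subr0.
by rewrite nth_nseq if_same (nth_default _ gej) Qtwo0.
Qed.

Section Vectors.
Variable R : realType.
Implicit Types (x : R) (A B : seq R).

Local Notation vec := (seq (R * option nat)).

Definition basis (i : option nat) : vec := [:: (1, i)].

(** Vectors are formal combinations of row indices, as lists of pairs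
    (coefficient, index); the form is extended bilinearly. *)
Definition vec_form A (v w : vec) : R :=
  \sum_(p <- v) \sum_(r <- w) p.1 * r.1 * pair_form A p.2 r.2.

(** The coefficient of z^r in (1 + x z) / (1 - x z) times the generating
    function of the basis vectors: the vector that replaces the row index r
    when x joins the alphabet. *)
Fixpoint shift_vec x (r : nat) : vec :=
  if r is r'.+1 then
    [:: (1, Some r), (x, Some r') & [seq (x * p.1, p.2) | p <- shift_vec x r']]
  else basis (Some 0%N).

(** Since [shift_vec x r.+1] is the basis vector at r+1 plus x times this
    vector, it is what remains to be placed in the columns up to r while a
    horizontal strip is being removed. *)
Definition carry_vec x (r : nat) : vec := (1, Some r) :: shift_vec x r.

Lemma vec_form_anti A v w : vec_form A v w = - vec_form A w v.
Proof.
rewrite /vec_form exchange_big -sumrN; apply: eq_bigr => p _ /=.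
rewrite -sumrN; apply: eq_bigr => r _; rewrite pair_form_anti; ring.
Qed.

Lemma vec_form_basis A i j : vec_form A (basis i) (basis j) = pair_form A i j.
Proof. by rewrite /vec_form !big_seq1 /= !mul1r. Qed.

Lemma vec_form_shift0 A x u :
  vec_form A (shift_vec x 0) u = vec_form A (basis (Some 0%N)) u.
Proof. by []. Qed.

Lemma vec_form_shift A x r u :
  vec_form A (shift_vec x r.+1) u =
  1 * vec_form A (basis (Some r.+1)) u + x * vec_form A (carry_vec x r) u.
Proof.
rewrite /vec_form /carry_vec /= !big_cons !big_nil !addr0 big_map /= mulrDr !mulr_sumr.
congr (_ + (_ + _)).
- by apply: eq_bigr => p _; rewrite !mul1r.
- by apply: eq_bigr => p _; rewrite !mul1r mulrA.
by apply: eq_bigr => p _; rewrite mulr_sumr; apply: eq_bigr => q _; rewrite !mulrA.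
Qed.

Lemma vec_form_carry A x r u :
  vec_form A (carry_vec x r) u =
  1 * vec_form A (basis (Some r)) u + 1 * vec_form A (shift_vec x r) u.
Proof. by rewrite /vec_form big_cons big_seq1 !mul1r. Qed.

Lemma vec_form_carry0 A x u :
  vec_form A (carry_vec x 0) u =
  1 * vec_form A (basis (Some 0%N)) u + 1 * vec_form A (basis (Some 0%N)) u.
Proof. by rewrite vec_form_carry. Qed.

Lemma vec_form_carryS A x r u :
  vec_form A (carry_vec x r.+1) u =
  2 * vec_form A (basis (Some r.+1)) u + x * vec_form A (carry_vec x r) u.
Proof. by rewrite vec_form_carry vec_form_shift; ring. Qed.

Lemma vec_form_shift_none A x r :
  vec_form A (shift_vec x r) (basis None) = qfun r (x :: A).
Proof.
elim: r => [|r IH]; first by rewrite vec_form_shift0 vec_form_basis /= !qfun0.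
by rewrite vec_form_shift vec_form_carry IH !vec_form_basis qfun_cons /=; ring.
Qed.

(** The form of [x :: A] and the shifted form of [A] satisfy the same
    recursion, by [Qtwo_cons], but differ on the boundary [s = 0]; the
    difference propagates by the recursion (1 - x z) (1 - x w) d = 2 x (z - w)
    and vanishes as soon as both indices are positive. *)
Lemma vec_form_shift_defect A x r s :
  pair_form (x :: A) (Some r) (Some s) - vec_form A (shift_vec x r) (shift_vec x s) =
  2 * x ^+ (r + s) * ((r != 0)%N%:R - (s != 0)%N%:R).
Proof.
pose d r s := pair_form (x :: A) (Some r) (Some s) - vec_form A (shift_vec x r) (shift_vec x s).
rewrite -/(d r s).
have d_anti r' s' : d r' s' = - d s' r'.
  by rewrite /d pair_form_anti vec_form_anti; ring.
have shiftE u r' : vec_form A (shift_vec x r'.+1) u = vec_form A (basis (Some r'.+1)) u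
    + x * vec_form A (basis (Some r')) u + x * vec_form A (shift_vec x r') u.
  by rewrite vec_form_shift vec_form_carry; ring.
have beta0 (C : seq R) r' : pair_form C (Some r'.+1) (Some 0%N) = qfun r'.+1 C.
  by rewrite /= subr0 Qtwo0.
have d0 r' : d r' 0%N = 2 * x ^+ r' * (r' != 0)%N%:R.
  case: r' => [|r']; first by rewrite /d /= vec_form_basis /= !Qtwo0 !qfun0; ring.
  elim: r' => [|r' IH].
    rewrite /d shiftE beta0 qfun_cons !vec_form_basis beta0 /= !Qtwo0 !qfun0.
    by ring.
  have -> : d r'.+2 0%N = x * d r'.+1 0%N.
    rewrite /d shiftE !vec_form_basis !beta0 qfun_cons; ring.
  by rewrite IH [in RHS]exprS; ring.
have dS r' s' : d r'.+1 s'.+1 = x * d r' s'.+1 + x * d r'.+1 s' - x ^+ 2 * d r' s'.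
  have q := Qtwo_cons r' s' x A.
  have bE' u : vec_form A u (shift_vec x s'.+1) = vec_form A u (basis (Some s'.+1))
      + x * vec_form A u (basis (Some s')) + x * vec_form A u (shift_vec x s').
    by rewrite vec_form_anti shiftE !(vec_form_anti _ u); ring.
  rewrite /d; rewrite !shiftE !bE' !vec_form_basis /pair_form /= !andbF /= !subr0.
  by lra.
elim: s r => [|s IH] r; first by rewrite d0 addn0 subr0.
elim: r => [|r IHr]; first by rewrite d_anti d0 add0n /=; ring.
rewrite dS IHr !IH !addSn !addnS /=.
by case: r {IHr} => [|r]; case: s {IH} => [|s] /=; rewrite ?addSn ?addnS !exprS; ring.
Qed.

Definition to_shift x (i : option nat) : vec :=
  if i is Some r then shift_vec x r else basis None.

(** All row indices of a strict partition are positive, so the defect of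
    [vec_form_shift_defect] never occurs; against the appended row [None] the
    shifted form is exact. *)
Lemma schurQ_shift x (la : seq nat) A :
  all (leq 1) la ->
  schurQ la (x :: A) =
    pf (vec_form A) (map (shift_vec x) la ++ nseq (odd (size la)) (basis None)).
Proof.
move=> la_gt0; rewrite schurQE //.
have -> : map (shift_vec x) la ++ nseq (odd (size la)) (basis None) =
    map (to_shift x) (map Some la ++ nseq (odd (size la)) None).
  by rewrite map_cat -map_comp map_nseq.
have pos r : Some r \in map Some la ++ nseq (odd (size la)) None -> (0 < r)%N.
  rewrite mem_cat => /orP[/mapP[r' /(allP la_gt0) ? [->]] //|].
  by case: (odd _).
apply: eq_pf => -[r|] [s|] /=.
- move=> /pos r0 /pos s0; apply/eqP; rewrite -subr_eq0.
  have /= -> := vec_form_shift_defect A x r s.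
  by rewrite -!lt0n r0 s0 subrr mulr0.
- by rewrite vec_form_shift_none.
- by rewrite vec_form_anti vec_form_shift_none.
- by rewrite vec_form_basis.
Qed.

Lemma schurQ_basis (la : seq nat) A :
  all (leq 1) la ->
  schurQ la A = pf (vec_form A)
    (map (basis \o Some) la ++ nseq (odd (size la)) (basis None)).
Proof.
move=> la_gt0; rewrite schurQE // (@eq_pf _ _ _ _ (vec_form A) basis).
  by rewrite map_cat -map_comp map_nseq.
by move=> v w _ _; rewrite vec_form_basis.
Qed.

End Vectors.

(** * Branching of Q-functions *)

(** The Boltzmann weight of a six-vertex model: [l] and [m] tell, from the
    largest column down, which columns are parts of la and mu, and the state
    [th] tells whether the horizontal strip la / mu meets the column just above.
    Each column of the strip contributes x, and each of its connected
    components 2, at its lower end; the result is Q_(la/mu)(x). *)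
Fixpoint strip_weight (R : nzRingType) (x : R) (th : bool) (l m : bitseq) : R :=
  match l, m with
  | [::], [::] => if th then 2 else 1
  | a :: l', c :: m' =>
    match th, a, c with
    | false, false, false | false, true, true => strip_weight x false l' m'
    | false, true, false | true, false, false | true, true, true =>
        x * strip_weight x true l' m'
    | true, false, true => 2 * strip_weight x false l' m'
    | _, _, _ => 0
    end
  | _, _ => 0
  end.

(** A bit sequence of size n stands for a strict partition with parts at most
    n; the head bit is about the part n. *)
Fixpoint parts (l : bitseq) : seq nat :=
  if l is a :: l' then nseq a (size l').+1 ++ parts l' else [::].

Fixpoint bitseqs (n : nat) : seq bitseq :=
  if n is n'.+1 then map (cons false) (bitseqs n') ++ map (cons true) (bitseqs n')
  else [:: [::]].

Lemma mem_bitseqs n l : (l \in bitseqs n) = (size l == n).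
Proof.
elim: n l => [|n IH] [|a l] //=.
  by rewrite mem_cat; apply/negP => /orP[] /mapP[].
have inj (b : bool) : injective (cons b) by move=> ? ? [].
rewrite mem_cat eqSS; case: a; rewrite (mem_map (inj _)) IH ?orbF //.
  by rewrite orbC; case: eqP => //= _; apply/negP => /mapP[].
by case: eqP => //= _; apply/negP => /mapP[].
Qed.

Lemma big_bitseqsS (R : nmodType) n (F : bitseq -> R) :
  \sum_(l <- bitseqs n.+1) F l =
  \sum_(l <- bitseqs n) F (false :: l) + \sum_(l <- bitseqs n) F (true :: l).
Proof. by rewrite big_cat !big_map. Qed.

Lemma parts_gt0 l : all (leq 1) (parts l).
Proof. by elim: l => //= -[]. Qed.

Section Branching.
Variable R : realType.
Implicit Types (x : R) (A B : seq R).

Local Notation vec := (seq (R * option nat)).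
Local Notation basis := (@basis R).

(** The Pfaffian of a list of vectors of any length, with the extra row added
    when the length is odd; a vacuum expectation of neutral fermions. *)
Definition wick A (s : seq vec) : R :=
  pf (vec_form A) (s ++ nseq (odd (size s)) (basis None)).

Definition bvec (r : nat) : vec := basis (Some r).

Lemma wick_linear A s1 v s2 c1 c2 w1 w2 :
  (forall u, vec_form A v u = c1 * vec_form A w1 u + c2 * vec_form A w2 u) ->
  wick A (s1 ++ v :: s2) = c1 * wick A (s1 ++ w1 :: s2) + c2 * wick A (s1 ++ w2 :: s2).
Proof.
move=> vE; rewrite /wick !size_cat /= -!catA !cat_cons.
exact: (pf_linear (vec_form_anti A) _ _ vE).
Qed.

Lemma wick_repeat A s1 v s2 : wick A (s1 ++ v :: v :: s2) = 0.
Proof.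
rewrite /wick -catA !cat_cons.
set t := (s2 ++ _); have := alternating_pf (vec_form_anti A) s1 v v t; lra.
Qed.

(** A part 0 at the end can be dropped.  For an odd number of positive parts it
    plays the role of the appended row; for an even number, the difference of
    0 and [None] is orthogonal to all the positive parts and pairs to 1 with
    [None], so this hyperbolic pair splits off. *)
Lemma wick_basis0 A ks : all (leq 1) ks ->
  wick A (map bvec ks ++ [:: bvec 0]) = wick A (map bvec ks).
Proof.
move=> ks_gt0; rewrite /wick size_cat addn1 /= -catA.
have agree k : k \in ks -> pair_form A (Some k) (Some 0%N) = pair_form A (Some k) None.
  by move=> /(allP ks_gt0); rewrite /= Qtwo0; case: k => //= k; rewrite subr0.
case: (boolP (odd (size (map bvec ks)))) => [_|even_ks] /=; last first.
  pose d : vec := [:: (1, Some 0%N); (-1, None)].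
  have dE u : vec_form A (bvec 0) u = 1 * vec_form A d u + 1 * vec_form A (basis None) u.
    rewrite /vec_form !big_cons !big_nil /= !addr0 !mul1r -!big_split /=.
    by apply: eq_bigr => r _; ring.
  rewrite (pf_linear (vec_form_anti A) _ _ dE) cats0.
  have -> : pf (vec_form A) (map bvec ks ++ [:: basis None; basis None]) = 0.
    have := alternating_pf (vec_form_anti A) (map bvec ks) (basis None)
      (basis None) [::]; lra.
  rewrite (pf_move (vec_form_anti A)) pf_cons cats1 contract_last.
    have -> : (-1) ^+ size (map bvec ks) = 1 :> R.
      by rewrite -signr_odd (negbTE even_ks).
    have -> : vec_form A d (basis None) = 1.
      by rewrite /vec_form !big_cons !big_nil /= qfun0; ring.
    by ring.
  move=> w /mapP[k ks_k ->]; rewrite /vec_form !big_cons !big_nil /=.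
  have := agree k ks_k; rewrite (pair_form_anti _ (Some k)) (pair_form_anti _ (Some k) None) /=; lra.
rewrite -[[:: bvec 0]]/(map basis [:: Some 0%N]).
rewrite -[[:: basis None]]/(map basis [:: None]).
have -> : map bvec ks = map basis (map Some ks) by rewrite -map_comp.
rewrite -!map_cat -!(@eq_pf _ _ _ (pair_form A)) => [|v w _ _|v w _ _];
  rewrite ?vec_form_basis //.
(* Replacing the index 0 by None changes no pairing within the list. *)
pose f (i : option nat) := if i == Some 0%N then None else i.
rewrite (@eq_pf _ _ _ _ (pair_form A) f) => [|v w].
  congr pf; rewrite map_cat; congr (_ ++ _); apply/map_id_in => i.
  by move=> /mapP[k /(allP ks_gt0) k_gt0 ->]; rewrite /f; case: k k_gt0.
rewrite !mem_cat !inE => vks wks.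
have fE k : k \in ks -> f (Some k) = Some k.
  by move=> /(allP ks_gt0); case: k.
case/orP: vks => [/mapP[k kks ->]|/eqP->];
  case/orP: wks => [/mapP[j jks ->]|/eqP->].
- by rewrite (fE _ kks) (fE _ jks).
- by rewrite (fE _ kks) agree.
- by rewrite (fE _ jks) pair_form_anti agree // [RHS]pair_form_anti.
- by rewrite /= Qtwo0 qfun0 subrr.
Qed.

(** The parts [ks] are those already emitted in the columns above [l]. *)
Definition branch_sum A x ks th l : R :=
  \sum_(m <- bitseqs (size l))
    strip_weight x th l m * wick A (map bvec (ks ++ parts m)).

Lemma branch_sum_cons A x ks th a l :
  branch_sum A x ks th (a :: l) =
  match th, a with
  | false, false => branch_sum A x ks false l
  | false, true => branch_sum A x (rcons ks (size l).+1) false l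
                   + x * branch_sum A x ks true l
  | true, false => 2 * branch_sum A x (rcons ks (size l).+1) false l
                   + x * branch_sum A x ks true l
  | true, true => x * branch_sum A x (rcons ks (size l).+1) true l
  end.
Proof.
rewrite /branch_sum [LHS]big_bitseqsS.
have -> : \sum_(m <- bitseqs (size l)) strip_weight x th (a :: l) (true :: m) *
      wick A (map bvec (ks ++ parts (true :: m))) =
    \sum_(m <- bitseqs (size l)) strip_weight x th (a :: l) (true :: m) *
      wick A (map bvec (rcons ks (size l).+1 ++ parts m)).
  apply: eq_big_seq => m; rewrite mem_bitseqs => /eqP sm /=.
  by rewrite sm cat_rcons.
case: th; case: a => /=; rewrite ?mulr_sumr.
- rewrite big1 ?add0r => [|m _]; last by rewrite mul0r.
  by apply: eq_bigr => m _; rewrite mulrA.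
- by rewrite addrC; congr (_ + _); apply: eq_bigr => m _; rewrite mulrA.
- by rewrite addrC; congr (_ + _); apply: eq_bigr => m _; rewrite mulrA.
- by rewrite [X in _ + X]big1 ?addr0 // => m _; rewrite mul0r.
Qed.

(** Column by column, a shifted vector either stays as a basis vector or passes
    a carry to the next column.  When a carry meets a shifted vector in the
    same column, alternation removes all but one of the possible terms. *)
Lemma wick_branch A x l ks : all (leq 1) ks ->
  wick A (map bvec ks ++ map (shift_vec x) (parts l)) = branch_sum A x ks false l /\
  wick A (map bvec ks ++ carry_vec x (size l) :: map (shift_vec x) (parts l)) =
    branch_sum A x ks true l.
Proof.
elim: l ks => [|a l IH] ks ks_gt0.
  rewrite /branch_sum !big_seq1 /= !cats0 mul1r; split=> //.
  by rewrite (wick_linear _ _ (@vec_form_carry0 _ A x)) wick_basis0 //; ring.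
have [IHF IHT] := IH _ ks_gt0.
have ks'_gt0 : all (leq 1) (rcons ks (size l).+1) by rewrite all_rcons ks_gt0.
have [IHF' IHT'] := IH _ ks'_gt0.
rewrite map_rcons cat_rcons in IHF'; rewrite map_rcons cat_rcons in IHT'.
rewrite !branch_sum_cons; case: a => /=.
  split; first by rewrite (wick_linear _ _ (vec_form_shift A x _)) IHF' IHT mul1r.
  rewrite (wick_linear _ _ (vec_form_carry A x _)) wick_repeat mulr0 addr0 mul1r.
  rewrite -cat_rcons (wick_linear _ _ (vec_form_shift A x _)) !cat_rcons.
  by rewrite wick_repeat mulr0 add0r IHT'.
split=> //.
by rewrite (wick_linear _ _ (vec_form_carryS A x _)) IHF' IHT.
Qed.

Lemma schurQ_wick A l : schurQ (parts l) A = wick A (map bvec (parts l)).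
Proof. by rewrite schurQ_basis ?parts_gt0 // /wick size_map. Qed.

Theorem schurQ_branch x l A :
  schurQ (parts l) (x :: A) =
  \sum_(m <- bitseqs (size l)) strip_weight x false l m * schurQ (parts m) A.
Proof.
rewrite schurQ_shift ?parts_gt0 //.
have [+ _] := wick_branch A x l (isT : all (leq 1) [::]).
rewrite /wick /= size_map => ->.
by apply: eq_bigr => m _; rewrite schurQ_wick.
Qed.

(** With no variable all q_r with r positive vanish, hence so does any row of
    the Pfaffian belonging to a positive part. *)
Lemma schurQ_nil l :
  schurQ (parts l) ([::] : seq R) = (l == nseq (size l) false)%:R.
Proof.
rewrite schurQE ?parts_gt0 //.
elim: l => [|[] l IH]; [by rewrite /pf /= | | exact: IH].
rewrite /= pf_cons contract_eq0 // => i _.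
have q0 r : qfun r.+1 ([::] : seq R) = 0 by rewrite qfun_nil.
case: i => [s|] /=; last exact: q0.
rewrite subr0 /Qtwo q0 mul0r big1 ?mulr0 ?addr0 // => i _.
by rewrite addSn q0 mulr0 mul0r.
Qed.

End Branching.

(** * Skew Q-functions *)

(** The inverse of [parts] on the strict partitions with parts at most [n]. *)
Fixpoint bits (n : nat) (la : seq nat) : bitseq :=
  if n is n'.+1 then (n \in la) :: bits n' la else [::].

Lemma size_bits n la : size (bits n la) = n.
Proof. by elim: n => //= n ->. Qed.

Lemma parts_le l : all (fun j => (j <= size l)%N) (parts l).
Proof.
elim: l => //= a l IH; rewrite all_cat all_nseq ltnSn orbT /=.
by apply: sub_all IH => j /= /leq_trans->.
Qed.

Lemma SP_parts l : SP (parts l).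
Proof.
split; last exact: parts_gt0.
elim: l => //= -[] //= l IH; rewrite path_sortedE; last exact/rev_trans/ltn_trans.
by rewrite IH andbT; apply: sub_all (parts_le l) => j; rewrite /= ltnS.
Qed.

Lemma eq_bits n la mu :
  (forall j, (j <= n)%N -> (j \in la) = (j \in mu)) -> bits n la = bits n mu.
Proof.
elim: n => //= n IH E; rewrite E // IH // => j lejn; apply: E; exact: leqW.
Qed.

Lemma partsK l : bits (size l) (parts l) = l.
Proof.
elim: l => //= a l IH; congr (_ :: _).
  rewrite mem_cat mem_nseq eqxx andbT lt0b.
  by rewrite [_ \in parts l](negbTE _) ?orbF //; apply/negP => /(allP (parts_le l)) /=; rewrite ltnn.
rewrite -[RHS]IH; apply: eq_bits => j lejl.
by rewrite mem_cat mem_nseq [j == _]ltn_eqF ?andbF.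
Qed.

Lemma mem_parts_bits n la j :
  (j \in parts (bits n la)) = (0 < j <= n)%N && (j \in la).
Proof.
elim: n => /= [|n IH]; first by case: j.
rewrite mem_cat mem_nseq size_bits IH lt0b.
case: (ltngtP j n.+1) => [ltjn|gtjn|->].
- have lejn : (j <= n)%N := ltjn.
  by rewrite andbF /= lejn.
- by rewrite andbF /= [(j <= n)%N]leqNgt (ltnW gtjn) /= !andbF.
- by rewrite ltnn andbT /= orbF.
Qed.

Lemma bitsK n la : SP la -> all (fun j => (j <= n)%N) la -> parts (bits n la) = la.
Proof.
move=> [la_sorted la_gt0] la_le.
have [parts_sorted _] := SP_parts (bits n la).
apply: (irr_sorted_eq (rev_trans ltn_trans) ltnn parts_sorted la_sorted) => j.
rewrite mem_parts_bits; case: (boolP (j \in la)) => [jla|_]; last by rewrite andbF.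
by rewrite (allP la_gt0 _ jla) (allP la_le _ jla).
Qed.

Lemma SP_le_head la : SP la -> all (fun j => (j <= head 0 la)%N) la.
Proof.
case: la => //= c la [/=]; rewrite path_sortedE; last exact/rev_trans/ltn_trans.
move=> /andP[lt_c _] _; rewrite leqnn; apply: sub_all lt_c => j; exact: ltnW.
Qed.

Lemma subpart_le n mu la :
  subpart mu la -> all (fun j => (j <= n)%N) la -> all (fun j => (j <= n)%N) mu.
Proof.
move=> sub la_le; apply/(all_nthP 0%N) => i _; apply: leq_trans (sub i) _.
case: (ltnP i (size la)) => [lti|gei]; last by rewrite nth_default.
exact: (all_nthP 0%N la_le).
Qed.

Lemma uniq_bitseqs n : uniq (bitseqs n).
Proof.
elim: n => //= n IH; rewrite cat_uniq !map_inj_uniq ?IH ?andbT => [|? ? []|? ? []] //.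
by apply/hasP => -[l /mapP[? _ ->] /mapP[? _]].
Qed.

Lemma parts_inj n : {in bitseqs n &, injective parts}.
Proof.
move=> l m; rewrite !mem_bitseqs => /eqP sl /eqP sm lm.
by rewrite -(partsK l) -(partsK m) lm sl sm.
Qed.

Section Skew.
Variable R : realType.
Implicit Types (x : R) (A B : seq R).

Lemma weight_size (T : nzRingType) (x : T) th l m :
  size l != size m -> strip_weight x th l m = 0.
Proof.
elim: l m th => [|a l IH] [|c m] // th; rewrite eqSS => lm /=.
by case: th; case: a; case: c; rewrite /= ?IH // mulr0.
Qed.

Lemma weight_ge0 x th l m : 0 <= x -> 0 <= strip_weight x th l m.
Proof.
move=> x_ge0; elim: l m th => [|a l IH] [|c m] th //=; first by case: th.
by case: th; case: a; case: c; rewrite ?mulr_ge0.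
Qed.

Lemma subpart_cons c mu la : subpart mu la -> subpart (c :: mu) (c :: la).
Proof. by move=> sub [|i] /=. Qed.

(** An open carry means that la has one more part than mu above the columns
    at hand; for the comparison it counts as a part in the top one. *)
Lemma weight_subpart (T : nzRingType) (x : T) th l m : strip_weight x th l m != 0 ->
  subpart (parts m) (nseq th (size l) ++ parts l).
Proof.
elim: l m th => [|a l IH] [|c m] th; rewrite ?eqxx //=.
  by move=> _ i; rewrite nth_nil.
have [sm|] := eqVneq (size m) (size l); last first.
  by rewrite eq_sym => lm; case: th; case: a; case: c; rewrite /= ?weight_size ?mulr0 ?eqxx.
have IHT : x * strip_weight x true l m != 0 ->
    subpart (parts m) ((size l).+1 :: parts l).
  have [->|/IH H _ i] := eqVneq (strip_weight x true l m) 0; first by rewrite mulr0 eqxx.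
  apply: leq_trans (H i) _; case: i => [|i] /=; [exact: leqnSn | exact: leqnn].
rewrite sm; case: th; case: a; case: c; rewrite /= ?eqxx //.
- by move/IHT; apply: subpart_cons.
- have [->|/IH H _] := eqVneq (strip_weight x false l m) 0; first by rewrite mulr0 eqxx.
  exact: subpart_cons.
- by move/IH; apply: subpart_cons.
- exact: IH.
Qed.

(** Q_(la/mu)(A) as a sum over chains of horizontal strips, one for each
    variable of A. *)
Fixpoint skew_bits A (l m : bitseq) : R :=
  if A is x :: A' then
    \sum_(k <- bitseqs (size l)) strip_weight x false l k * skew_bits A' k m
  else (l == m)%:R.

Lemma skew_bits_ge0 A l m : {in A, forall x, 0 <= x} -> 0 <= skew_bits A l m.
Proof.
elim: A l => [|x A IH] l A_ge0 /=; first exact: ler0n.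
apply: sumr_ge0 => k _; apply: mulr_ge0.
  by apply: weight_ge0; apply: A_ge0; apply: mem_head.
by apply: IH => y yA; rewrite A_ge0 // inE yA orbT.
Qed.

Lemma skew_bits_subpart A l m :
  skew_bits A l m != 0 -> subpart (parts m) (parts l).
Proof.
elim: A l => [|x A IH] l /=; first by case: (l =P m) => [->|_]; rewrite ?mulr0n ?eqxx // => _ i.
have [/hasP[k _ /=]|/hasPn nz] := boolP (has
    (fun k => strip_weight x false l k * skew_bits A k m != 0)
    (bitseqs (size l))).
  have [->|/weight_subpart lk] := eqVneq (strip_weight x false l k) 0; first by rewrite mul0r eqxx.
  have [->|/IH km _ _ i] := eqVneq (skew_bits A k m) 0; first by rewrite mulr0 eqxx.
  exact: leq_trans (km i) (lk i).
by rewrite big1_seq ?eqxx // => k /andP[_ /nz]; rewrite negbK => /eqP.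
Qed.

Lemma schurQ_cat l A B :
  schurQ (parts l) (A ++ B) =
  \sum_(m <- bitseqs (size l)) skew_bits A l m * schurQ (parts m) B.
Proof.
elim: A l => [|x A IH] l /=.
  rewrite (bigD1_seq l) ?mem_bitseqs ?uniq_bitseqs //= eqxx mul1r big1 ?addr0 //.
  by move=> m; rewrite eq_sym => /negbTE->; rewrite mul0r.
rewrite schurQ_branch.
under [RHS]eq_bigr do rewrite mulr_suml.
rewrite exchange_big /=; apply: eq_big_seq => k; rewrite mem_bitseqs => /eqP sk.
by rewrite IH sk mulr_sumr; apply: eq_bigr => m _; rewrite mulrA.
Qed.

(** Taking mu empty exhibits Q_la as a polynomial with nonnegative
    coefficients. *)
Lemma schurQ_skew l A :
  schurQ (parts l) A = skew_bits A l (nseq (size l) false).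
Proof.
rewrite -[in LHS](cats0 A) schurQ_cat.
rewrite (bigD1_seq (nseq (size l) false)) ?uniq_bitseqs ?mem_bitseqs ?size_nseq //=.
rewrite schurQ_nil size_nseq eqxx mulr1 big1_seq ?addr0 // => m.
rewrite mem_bitseqs => /andP[/negbTE nm /eqP sm].
by rewrite schurQ_nil sm nm mulr0.
Qed.

Lemma schurQ_ge0 la A : SP la -> {in A, forall x, 0 <= x} -> 0 <= schurQ la A.
Proof.
move=> SPla A_ge0; rewrite -(bitsK SPla (SP_le_head SPla)) schurQ_skew.
exact: skew_bits_ge0.
Qed.

Definition skew_parts la mu A : R :=
  skew_bits A (bits (head 0%N la) la) (bits (head 0%N la) mu).

Lemma fsbig_parts n (D : set (seq nat)) (F : seq nat -> R) :
  (forall mu, D mu -> SP mu /\ all (fun j => (j <= n)%N) mu) ->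
  \sum_(mu \in D) F mu = \sum_(m <- bitseqs n | parts m \in D) F (parts m).
Proof.
move=> Dn; rewrite (fsbigE [seq mu <- map parts (bitseqs n) | mu \in D]).
- by rewrite big_filter_cond big_map; apply: eq_bigl => m; rewrite andbb.
- by rewrite filter_uniq // map_inj_in_uniq ?uniq_bitseqs //; apply: parts_inj.
- by move=> mu /=; rewrite mem_filter => /andP[]; rewrite inE.
move=> mu Dmu; have [SPmu mun] := Dn mu Dmu.
rewrite mem_filter mem_set //= => /negP[].
by apply/mapP; exists (bits n mu); rewrite ?bitsK // mem_bitseqs size_bits.
Qed.

Lemma subpart_SP_le la mu : SP la ->
  (SP `&` [set mu | subpart mu la])%classic mu ->
  SP mu /\ all (fun j => (j <= head 0 la)%N) mu.
Proof.
by move=> SPla [SPmu sub]; split=> //; apply: subpart_le sub (SP_le_head SPla).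
Qed.

(** Every mu contained in la has its parts bounded by the largest part of la,
    so the sum can be taken over bit sequences of that size; the additional
    bit sequences carry the value 0 by [skew_bits_subpart]. *)
Lemma skew_parts_is_skewQ : is_skewQ skew_parts.
Proof.
move=> la SPla A B.
rewrite (fsbig_parts _ (fun mu => @subpart_SP_le la mu SPla)).
rewrite -[in LHS](bitsK SPla (SP_le_head SPla)) schurQ_cat size_bits [RHS]big_mkcond.
apply: eq_big_seq => m; rewrite mem_bitseqs => /eqP sm.
rewrite /skew_parts -[in bits _ (parts m)]sm partsK.
case: ifPn => //; rewrite notin_setE => notsub.
have [->|nz] := eqVneq (skew_bits A (bits (head 0%N la) la) m) 0; first by rewrite mul0r.
case: notsub; split; first exact: SP_parts.
by rewrite -(bitsK SPla (SP_le_head SPla)); apply: skew_bits_subpart nz.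
Qed.

Lemma poly2 : 2 = (2 : R)%:P.
Proof. by rewrite polyC_natr. Qed.

Lemma weight_horner x th l m : strip_weight x th l m = (strip_weight 'X th l m).[x].
Proof.
elim: l m th => [|a l IH] [|c m] th /=; rewrite ?horner0 //.
  by case: th; rewrite ?hornerC // poly2 hornerC.
by case: th; case: a; case: c; rewrite /= ?horner0 // ?IH // hornerM ?hornerX // poly2 hornerC.
Qed.

Lemma coef_weight_gt th l m i : (size l < i)%N ->
  (strip_weight ('X : {poly R}) th l m)`_i = 0.
Proof.
elim: l m th i => [|a l IH] [|c m] th [|i] //=; rewrite ?coef0 //.
  by case: th; rewrite ?poly2 ?coefC ?coef1.
rewrite ltnS => lti.
case: th; case: a; case: c; rewrite /= ?coef0 // ?coefXM ?IH //; try exact: leqW.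
by rewrite poly2 coefCM IH ?mulr0 // leqW.
Qed.

Lemma coef_weight_true l m : size l = size m ->
  (strip_weight ('X : {poly R}) true l m)`_(size l) = 2 * (l == m)%:R.
Proof.
elim: l m => [|a l IH] [|c m] //=; first by rewrite poly2 coefC mulr1.
move=> [lm]; rewrite eqseq_cons; case: a; case: c => /=; rewrite ?coef0 ?mulr0 ?coefXM ?IH //.
by rewrite poly2 coefCM coef_weight_gt ?mulr0.
Qed.

(** The power of x that equals the number of columns is only reached by
    removing the largest possible part as a strip of its own and leaving all
    other parts unchanged. *)
Lemma coef_weight_false a l c m : size l = size m ->
  (strip_weight ('X : {poly R}) false (a :: l) (c :: m))`_(size l).+1 =
  2 * [&& a, ~~ c & l == m]%:R.
Proof.
move=> lm; case: a; case: c; rewrite /= ?coef0 ?mulr0 ?coef_weight_gt //.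
by rewrite coefXM /= coef_weight_true.
Qed.

Lemma poly_eq0_horner (p : {poly R}) : (forall x, p.[x] = 0) -> p = 0.
Proof.
move=> p0; apply: (@roots_geq_poly_eq0 _ _ [seq i%:R | i <- iota 0 (size p)]).
- by apply/allP => x _; apply/eqP; apply: p0.
- rewrite map_inj_uniq ?iota_uniq //.
  by move=> i j /eqP; rewrite eqr_nat => /eqP.
by rewrite size_map size_iota.
Qed.

(** Linear independence of the Q-functions.  In the coefficient of the highest
    power of an additional variable only the partitions with the largest part
    survive, with that part removed, which allows induction on the largest
    part. *)
Lemma schurQ_free n (c : bitseq -> R) :
  (forall B, \sum_(m <- bitseqs n) c m * schurQ (parts m) B = 0) ->
  {in bitseqs n, forall m, c m = 0}.
Proof.
elim: n c => [|n IH] c c0.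
  move=> m; rewrite inE => /eqP->; have := c0 [::].
  by rewrite big_seq1 schurQ_nil eqxx mulr1.
have cT : {in bitseqs n, forall m, c (true :: m) = 0}.
  apply: IH => B.
  (* The vanishing combination for the alphabet x :: B, as a polynomial in x. *)
  pose p : {poly R} := \sum_(m <- bitseqs n.+1) \sum_(k <- bitseqs n.+1)
    (c m * schurQ (parts k) B) *: strip_weight 'X false m k.
  have p0 : p = 0.
    apply: poly_eq0_horner => x; rewrite -[RHS](c0 (x :: B)) horner_sum.
    apply: eq_big_seq => m; rewrite mem_bitseqs => /eqP sm.
    rewrite schurQ_branch sm horner_sum mulr_sumr; apply: eq_bigr => k _.
    by rewrite hornerZ -weight_horner; ring.
  have coefE (a : bool) (s : bitseq) : s \in bitseqs n ->
      (\sum_(k <- bitseqs n.+1)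
         (c (a :: s) * schurQ (parts k) B) *: strip_weight 'X false (a :: s) k)`_n.+1
      = a%:R * 2 * (c (a :: s) * schurQ (parts s) B).
    move=> sn; rewrite coef_sum big_bitseqsS.
    have sz (k : bitseq) : k \in bitseqs n -> size s = size k.
      by move: sn; rewrite !mem_bitseqs => /eqP-> /eqP->.
    have szs : size s = n by apply/eqP; rewrite -mem_bitseqs.
    rewrite [X in _ + X]big1_seq => [|k /andP[_ kn]]; last first.
      rewrite coefZ -[in X in _`_X]szs coef_weight_false ?(sz k kn) //=.
      by rewrite andbF !mulr0.
    rewrite (bigD1_seq s) ?uniq_bitseqs // [X in _ + X + _]big1_seq => [|k /andP[ks kn]].
      rewrite coefZ -[in X in _`_X]szs coef_weight_false // eqxx andbT !addr0.
      by rewrite /= andbT; ring.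
    rewrite coefZ -[in X in _`_X]szs coef_weight_false ?(sz k kn) //.
    by rewrite eq_sym (negbTE ks) !andbF !mulr0.
  have := congr1 (fun q : {poly R} => q`_n.+1) p0.
  rewrite /p big_bitseqsS coefD !coef_sum coef0.
  rewrite (eq_big_seq _ (coefE false)) (eq_big_seq _ (coefE true)).
  rewrite -!mulr_sumr !mul0r add0r mul1r => /eqP.
  by rewrite mulf_eq0 pnatr_eq0 => /eqP.
have cF : {in bitseqs n, forall m, c (false :: m) = 0}.
  apply: IH => B; rewrite -[RHS](c0 B) big_bitseqsS [X in _ + X]big1_seq ?addr0 //.
  by move=> m /andP[_ mn]; rewrite cT ?mul0r.
move=> [|a m]; rewrite mem_bitseqs // eqSS -mem_bitseqs => mn.
by case: a; [apply: cT | apply: cF].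
Qed.

Lemma skewQ_is_skewQ : is_skewQ (@skewQ R).
Proof.
apply: (@xgetPex _ _ [set f | is_skewQ f]%classic).
by exists skew_parts; apply: skew_parts_is_skewQ.
Qed.

Lemma skewQE la mu A : SP la -> SP mu -> subpart mu la ->
  skewQ la mu A = skew_parts la mu A.
Proof.
move=> SPla SPmu sub.
set n := head 0%N la.
have [_ mun] := @subpart_SP_le la mu SPla (conj SPmu sub).
pose c m := if parts m \in (SP `&` [set mu | subpart mu la])%classic then
  skewQ la (parts m) A - skew_parts la (parts m) A else 0.
have : c (bits n mu) = 0.
  apply: (@schurQ_free n c); last by rewrite mem_bitseqs size_bits.
  move=> B; have := skewQ_is_skewQ SPla A B; rewrite skew_parts_is_skewQ //.
  rewrite !(fsbig_parts _ (fun mu => @subpart_SP_le la mu SPla)) => /eqP.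
  rewrite eq_sym -subr_eq0 -sumrB big_mkcond => /eqP e; rewrite -[RHS]e.
  apply: eq_bigr => m _.
  by rewrite /c; case: ifP; rewrite ?mul0r // mulrBl.
rewrite /c bitsK // mem_set; last by split.
by move/eqP; rewrite subr_eq0 => /eqP.
Qed.

Lemma skewQ_ge0 la mu A : SP la -> SP mu -> subpart mu la ->
  {in A, forall x, 0 <= x} -> 0 <= skewQ la mu A.
Proof. by move=> *; rewrite skewQE //; apply: skew_bits_ge0. Qed.

End Skew.

(** * Sums over strict partitions *)

Section HasSum.
Variable R : realType.
Implicit Types (f g h : seq nat -> R) (F : seq nat -> seq nat -> R).

(** Nonnegative families with a finite sum: [has_sum_swap] exchanges double
    sums, while truncations by the largest part give explicit values. *)
Definition has_sum f (S : R) : Prop := (\esum_(la in SP) (f la)%:E)%E = S%:E.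

Definition truncated_sum f n : R := \sum_(l <- bitseqs n) f (parts l).

Lemma truncated_sum_fsbig f n :
  truncated_sum f n = \sum_(la \in [set` map parts (bitseqs n)]) f la.
Proof.
rewrite -fsbig_seq ?big_map //.
by rewrite map_inj_in_uniq ?uniq_bitseqs //; apply: parts_inj.
Qed.

Lemma truncated_sum_le f n : (forall la, SP la -> 0 <= f la) ->
  truncated_sum f n <= truncated_sum f n.+1.
Proof.
move=> f_ge0; rewrite /truncated_sum big_bitseqsS lerDl.
by apply: sumr_ge0 => l _; apply: f_ge0; apply: (SP_parts (true :: l)).
Qed.

Lemma cvg_has_sum f S : (forall la, SP la -> 0 <= f la) ->
  (truncated_sum f @ \oo --> S)%classic -> has_sum f S.
Proof.
move=> f_ge0 fS; have ndec : {homo truncated_sum f : n m / (n <= m)%N >-> n <= m}.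
  by apply/nondecreasing_seqP => n; apply: truncated_sum_le.
have ub n : truncated_sum f n <= S.
  rewrite -(cvg_lim (@Rhausdorff R) fS).
  by apply: nondecreasing_cvgn_le => //; apply/cvg_ex; exists S.
apply/eqP; rewrite eq_le; apply/andP; split.
  apply: ge_ereal_sup => _ /= [D [finD DSP] <-].
  (* Any bound on the parts occurring in the finite set D. *)
  pose n := \max_(la <- finmap.enum_fset (fset_set D)) head 0%N la.
  have Dn la : D la -> SP la /\ all (fun j => (j <= n)%N) la.
    move=> Dla; split; first exact: DSP.
    apply: sub_all (SP_le_head (DSP _ Dla)) => j /leq_trans -> //.
    rewrite /n (big_rem la) /= ?leq_maxl // in_fset_set // inE.
    exact: Dla.
  rewrite fsumEFin // lee_fin (fsbig_parts _ Dn); apply: le_trans (ub n).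
  rewrite big_mkcond; apply: ler_sum => l _; case: ifP => // _.
  by apply: f_ge0; apply: SP_parts.
have ge_trunc n : ((truncated_sum f n)%:E <= \esum_(la in SP) (f la)%:E)%E.
  apply: esum_ge; exists [set` map parts (bitseqs n)]%classic.
    split; first exact: finite_seq.
    by move=> _ /= /mapP[l _ ->]; apply: SP_parts.
  by rewrite truncated_sum_fsbig fsumEFin //; apply: finite_seq.
case: (\esum_(la in SP) (f la)%:E)%E ge_trunc => [r|_|/(_ 0%N)//]; last exact: leey.
move=> le_r; rewrite lee_fin -(cvg_lim (@Rhausdorff R) fS).
by apply: limr_le; [apply/cvg_ex; exists S | apply: nearW => n; rewrite -lee_fin].
Qed.

Lemma has_sum_cvg f S : (forall la, SP la -> 0 <= f la) ->
  has_sum f S -> (truncated_sum f @ \oo --> S)%classic.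
Proof.
move=> f_ge0 fS; have ndec : {homo truncated_sum f : n m / (n <= m)%N >-> n <= m}.
  by apply/nondecreasing_seqP => n; apply: truncated_sum_le.
have ub : has_ubound (range (truncated_sum f)).
  exists S => _ [n _ <-]; rewrite -lee_fin -fS truncated_sum_fsbig; apply: esum_ge.
  exists [set` map parts (bitseqs n)]%classic.
    split; first exact: finite_seq.
    by move=> _ /= /mapP[l _ ->]; apply: SP_parts.
  by rewrite fsumEFin //; apply: finite_seq.
have c := nondecreasing_cvgn ndec ub.
have := cvg_has_sum f_ge0 c; rewrite /has_sum fS => -[SE].
by rewrite SE.
Qed.

Lemma eq_has_sum f g S : (forall la, SP la -> f la = g la) ->
  has_sum f S -> has_sum g S.
Proof. by move=> fg; rewrite /has_sum => <-; apply: eq_esum => la /fg ->. Qed.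

Lemma has_sumZ c f S : 0 <= c -> (forall la, SP la -> 0 <= f la) ->
  has_sum f S -> has_sum (fun la => c * f la) (c * S).
Proof.
move=> c_ge0 f_ge0 fS; apply: cvg_has_sum => [la SPla|].
  by rewrite mulr_ge0 ?f_ge0.
rewrite (_ : truncated_sum _ = fun n => c * truncated_sum f n).
  by apply: (cvgM (cvg_cst _)); apply: has_sum_cvg.
by apply/funext => n; rewrite /truncated_sum mulr_sumr.
Qed.

Lemma has_sum_eventually f S N : (forall la, SP la -> 0 <= f la) ->
  (forall n, (N <= n)%N -> truncated_sum f n = S) -> has_sum f S.
Proof.
move=> f_ge0 fS; apply: cvg_has_sum => //.
apply: cvg_near_cst; exists N => // n; exact: fS.
Qed.

Lemma has_sum_swap F g h S :
  (forall la mu, SP la -> SP mu -> 0 <= F la mu) ->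
  (forall la, SP la -> has_sum (F la) (g la)) ->
  (forall mu, SP mu -> has_sum (F^~ mu) (h mu)) ->
  has_sum g S -> has_sum h S.
Proof.
move=> F_ge0 Fg Fh; rewrite /has_sum => <-.
transitivity (\esum_(mu in SP) \esum_(la in SP) (F la mu)%:E)%E.
  by apply: eq_esum => mu /Fh.
transitivity (\esum_(la in SP) \esum_(mu in SP) (F la mu)%:E)%E; last first.
  by apply: eq_esum => la /Fg.
rewrite !esum_esum => [|la mu SPla SPmu|mu la SPmu SPla]; try by rewrite lee_fin F_ge0.
rewrite (reindex_esum (SP `*` SP) _ (fun p => (p.2, p.1))) //; split => //=.
- by move=> [la mu] [].
- by move=> [? ?] [? ?] _ _ [-> ->].
by move=> [mu la] [SPmu SPla]; exists (la, mu).
Qed.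

End HasSum.

(** * The exchange relation of strip weights *)

Section SkewCauchy.
Variable R : realType.
Implicit Types (x y : R) (l m n k : bitseq).

(** The local weight isolated from [strip_weight], so that sums over one
    column can be written for all states at once. *)
Definition site_factor x (th a c : bool) : R :=
  match th, a, c with
  | false, false, false | false, true, true => 1
  | false, true, false | true, false, false | true, true, true => x
  | true, false, true => 2
  | _, _, _ => 0
  end.

Definition site_carry (th a c : bool) : bool :=
  match th, a, c with
  | false, true, false | true, false, false | true, true, true => true
  | _, _, _ => false
  end.

Lemma weight_cons x th a l c m :
  strip_weight x th (a :: l) (c :: m) =
  site_factor x th a c * strip_weight x (site_carry th a c) l m.
Proof. by case: th; case: a; case: c; rewrite /= ?mul1r ?mul0r. Qed.

Definition nparts l : nat := size (parts l).

Lemma nparts_cons a l : nparts (a :: l) = (a + nparts l)%N.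
Proof. by rewrite /nparts /= size_cat size_nseq. Qed.

(** Partition function of two rows of the six-vertex model whose shared
    boundary [l] lies above both [m] and [n]; [down_sum] has its shared
    boundary [k] below.  The powers of 2 turn Q-weights into P-weights, up to a
    factor common to both sides. *)
Definition up_sum x y th et m n : R :=
  \sum_(l <- bitseqs (size m))
    2 ^- nparts l * strip_weight y th l m * strip_weight x et l n.

Definition down_sum x y th et m n : R :=
  \sum_(k <- bitseqs (size m))
    2 ^- nparts m * 2 ^- nparts n * 2 ^+ nparts k *
    strip_weight x th m k * strip_weight y et n k.

Lemma up_sum_cons x y th et c m d n :
  up_sum x y th et (c :: m) (d :: n) =
    site_factor y th false c * site_factor x et false d *
      up_sum x y (site_carry th false c) (site_carry et false d) m n +
    2^-1 * site_factor y th true c * site_factor x et true d *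
      up_sum x y (site_carry th true c) (site_carry et true d) m n.
Proof.
rewrite /up_sum big_bitseqsS !mulr_sumr; congr (_ + _); apply: eq_bigr => l _;
  rewrite !weight_cons nparts_cons ?add0n ?add1n ?exprS ?invfM; ring.
Qed.

Lemma down_sum_cons x y th et c m d n :
  down_sum x y th et (c :: m) (d :: n) =
    2 ^- c * 2 ^- d *
    (site_factor x th c false * site_factor y et d false *
       down_sum x y (site_carry th c false) (site_carry et d false) m n +
     2 * site_factor x th c true * site_factor y et d true *
       down_sum x y (site_carry th c true) (site_carry et d true) m n).
Proof.
rewrite /down_sum big_bitseqsS mulrDr !mulr_sumr; congr (_ + _); apply: eq_bigr => l _;
  rewrite !weight_cons !nparts_cons !exprD ?expr0 ?expr1 !invfM; ring.
Qed.

(** The Yang-Baxter equation of this free-fermion six-vertex model, as the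
    intertwining of the column transfer matrices of [up_sum] and [down_sum].
    The first relation is the one of interest; the others are its closure
    under adding a column. *)
Lemma exchange_relations x y m n : size m = size n ->
  [/\ (1 - x * y) * up_sum x y false false m n + x * y / 2 * up_sum x y true true m n
        = (1 + x * y) * down_sum x y false false m n,
      8 * up_sum x y false false m n - (1 - x * y) * up_sum x y true true m n
        = (1 + x * y) * down_sum x y true true m n,
      4 * up_sum x y false false m n + x * y * up_sum x y true true m n
        = 4 * down_sum x y false false m n + x * y * down_sum x y true true m n,
      up_sum x y false true m n = down_sum x y true false m n
    & up_sum x y true false m n = down_sum x y false true m n].
Proof.
elim: m n => [|c m IH] [|d n] //.
  move=> _; rewrite /up_sum /down_sum !big_seq1 /= /nparts /= !expr0 !invr1.
  by split; lra.
move=> [/IH[e1 e2 e3 e4 e5]]; rewrite !up_sum_cons !down_sum_cons.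
have := congr1 (fun z => x * y * z) e1; have := congr1 (fun z => x * y * z) e2.
have := congr1 (fun z => x * y * z) e3.
case: c; case: d; rewrite /= ?expr0 ?expr1 ?invr1 ?e4 ?e5 => *; split; lra.
Qed.

End SkewCauchy.

(** * Pieri rule and Cauchy identity *)

Lemma bits_stable n n' la : all (fun j => (j <= n)%N) la -> (n <= n')%N ->
  bits n' la = nseq (n' - n) false ++ bits n la.
Proof.
move=> la_le; elim: n' => [|n' IH]; first by rewrite leqn0 => /eqP->.
rewrite leq_eqVlt => /orP[/eqP->|]; first by rewrite subnn.
rewrite ltnS => le_nn'; rewrite subSn //= -IH //; congr (_ :: _).
by apply/negbTE/negP => /(allP la_le) /=; rewrite leqNgt ltnS le_nn'.
Qed.

Section Cauchy.
Variable R : realType.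
Implicit Types (x y : R) (A B X Y : seq R).

(** The weight does not depend on the number of columns, as long as both
    partitions fit; see [pweightE]. *)
Definition pweight x (la mu : seq nat) : R :=
  let n := maxn (head 0%N la) (head 0%N mu) in
  strip_weight x false (bits n la) (bits n mu).

Lemma weight_stable x n l m :
  strip_weight x false (nseq n false ++ l) (nseq n false ++ m) = strip_weight x false l m.
Proof. by elim: n. Qed.

Lemma SP_le n la : SP la -> (head 0 la <= n)%N -> all (fun j => (j <= n)%N) la.
Proof. by move=> /SP_le_head le_la ln; apply: sub_all le_la => j /leq_trans->. Qed.

Lemma pweightE n x la mu : SP la -> SP mu ->
  (head 0 la <= n)%N -> (head 0 mu <= n)%N ->
  pweight x la mu = strip_weight x false (bits n la) (bits n mu).
Proof.
move=> SPla SPmu lan mun; rewrite /pweight; set n0 := maxn _ _.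
have n0n : (n0 <= n)%N by rewrite geq_max lan.
by rewrite !(@bits_stable n0 n) ?weight_stable // SP_le // leq_max leqnn ?orbT.
Qed.

Lemma head_parts l : (head 0 (parts l) <= size l)%N.
Proof. by have := parts_le l; case: (parts l) => //= c s /andP[]. Qed.

Lemma pweight_ge0 x la mu : 0 <= x -> 0 <= pweight x la mu.
Proof. by move=> x_ge0; apply: weight_ge0. Qed.

Lemma nparts_bits n la : SP la -> (head 0 la <= n)%N -> nparts (bits n la) = size la.
Proof. by move=> SPla lan; rewrite /nparts bitsK ?SP_le. Qed.

Lemma has_sum_branch x la B : 0 <= x -> {in B, forall b, 0 <= b} -> SP la ->
  has_sum (fun mu => pweight x la mu * schurQ mu B) (schurQ la (x :: B)).
Proof.
move=> x_ge0 B_ge0 SPla; apply: (@has_sum_eventually _ _ _ (head 0%N la)).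
  by move=> mu SPmu; rewrite mulr_ge0 ?pweight_ge0 ?schurQ_ge0.
move=> n lan; rewrite -[in RHS](bitsK SPla (SP_le SPla lan)) schurQ_branch size_bits.
apply: eq_big_seq => m; rewrite mem_bitseqs => /eqP sm; congr (_ * _).
have SPm := SP_parts m; rewrite (@pweightE n) //; last by rewrite -sm head_parts.
by rewrite -[in bits n (parts m)]sm partsK.
Qed.

(** The finite side of the skew Cauchy identity in one pair of variables. *)
Definition skew_cauchy_dual x y mu nu : R :=
  let n := maxn (head 0%N mu) (head 0%N nu) in
  down_sum x y false false (bits n mu) (bits n nu).

Lemma down_sum_stable x y n l m :
  down_sum x y false false (nseq n false ++ l) (nseq n false ++ m) =
  down_sum x y false false l m.
Proof.
elim: n => //= n IH; rewrite down_sum_cons /= IH !expr0 invr1; ring.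
Qed.

Lemma up_sum11_stable x y n l m :
  up_sum x y true true (nseq n false ++ l) (nseq n false ++ m) =
  (x * y) ^+ n * up_sum x y true true l m.
Proof.
elim: n => [|n IH] /=; first by rewrite mul1r.
by rewrite up_sum_cons /= IH exprS; ring.
Qed.

Lemma has_sum_down x y mu nu : 0 <= x -> 0 <= y -> SP mu -> SP nu ->
  has_sum (fun ka => 2 ^- size mu * 2 ^- size nu * 2 ^+ size ka *
             pweight x mu ka * pweight y nu ka) (skew_cauchy_dual x y mu nu).
Proof.
move=> x_ge0 y_ge0 SPmu SPnu.
apply: (@has_sum_eventually _ _ _ (maxn (head 0%N mu) (head 0%N nu))).
  by move=> ka _; rewrite !mulr_ge0 ?pweight_ge0 ?invr_ge0 ?exprn_ge0.
move=> n n0n; rewrite /skew_cauchy_dual; set n0 := maxn _ _ in n0n *.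
have mun0 : (head 0 mu <= n0)%N by rewrite leq_max leqnn.
have nun0 : (head 0 nu <= n0)%N by rewrite leq_max leqnn orbT.
have mun := leq_trans mun0 n0n; have nun := leq_trans nun0 n0n.
rewrite -(down_sum_stable _ _ (n - n0)) -!bits_stable ?SP_le //.
rewrite /down_sum size_bits; apply: eq_big_seq => k; rewrite mem_bitseqs => /eqP sk.
have SPk := SP_parts k; have kn : (head 0 (parts k) <= n)%N by rewrite -sk head_parts.
rewrite !nparts_bits // !(@pweightE n) //.
by rewrite -[in bits n (parts k)]sk partsK.
Qed.

(** The skew Cauchy identity in one pair of variables.  In the n columns above
    mu and nu, the pair of open carries only acquires the factor (x y)^n, so
    the first exchange relation gives the identity in the limit. *)
Lemma has_sum_up x y mu nu : 0 <= x -> 0 <= y -> x * y < 1 -> SP mu -> SP nu ->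
  has_sum (fun la => 2 ^- size la * pweight y la mu * pweight x la nu)
          ((1 + x * y) / (1 - x * y) * skew_cauchy_dual x y mu nu).
Proof.
move=> x_ge0 y_ge0 xy_lt1 SPmu SPnu.
apply: cvg_has_sum.
  by move=> ka _; rewrite !mulr_ge0 ?pweight_ge0 ?invr_ge0 ?exprn_ge0.
rewrite /skew_cauchy_dual; set n0 := maxn _ _.
have mun0 : (head 0 mu <= n0)%N by rewrite leq_max leqnn.
have nun0 : (head 0 nu <= n0)%N by rewrite leq_max leqnn orbT.
set D := down_sum _ _ _ _ _ _; set U := up_sum x y true true (bits n0 mu) (bits n0 nu).
rewrite -(cvg_shiftn n0).
rewrite (_ : (fun n => _) = fun i =>
    (1 + x * y) / (1 - x * y) * D - x * y / 2 / (1 - x * y) * U * (x * y) ^+ i); last first.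
  apply/funext => i /=.
  have mun : (head 0 mu <= i + n0)%N by exact: leq_trans (leq_addl _ _).
  have nun : (head 0 nu <= i + n0)%N by exact: leq_trans (leq_addl _ _).
  have -> : truncated_sum (fun la => 2 ^- size la * pweight y la mu * pweight x la nu) (i + n0) =
      up_sum x y false false (bits (i + n0) mu) (bits (i + n0) nu).
    rewrite /up_sum size_bits; apply: eq_big_seq => l; rewrite mem_bitseqs => /eqP sl.
    have SPl := SP_parts l; have ln : (head 0 (parts l) <= i + n0)%N by rewrite -sl head_parts.
    rewrite !(@pweightE (i + n0)) //.
    by rewrite -[in bits _ (parts l)]sl partsK.
  have [|e _ _ _ _] := @exchange_relations _ x y (bits (i + n0) mu) (bits (i + n0) nu).
    by rewrite !size_bits.
  move: e; rewrite !(@bits_stable n0 (i + n0)) ?SP_le ?leq_addl // addnK.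
  rewrite down_sum_stable up_sum11_stable -/D -/U => e.
  have nz : 1 - x * y != 0 by rewrite subr_eq0 eq_sym lt_eqF.
  set u := up_sum x y false false _ _ in e *.
  have -> : u = ((1 + x * y) * D - x * y / 2 * ((x * y) ^+ i * U)) / (1 - x * y).
    by rewrite -e addrK mulrC mulKf.
  by field.
have c0 : ((fun i => x * y / 2 / (1 - x * y) * U * (x * y) ^+ i) @ \oo --> (0 : R))%classic.
  rewrite -[X in (_ --> X)%classic](mulr0 (x * y / 2 / (1 - x * y) * U)).
  by apply: (cvgM (cvg_cst _)); apply: cvg_expr; rewrite ger0_norm ?mulr_ge0.
have := cvgB (cvg_cst ((1 + x * y) / (1 - x * y) * D)) c0.
by rewrite subr0; apply.
Qed.

Lemma weight_empty x l : strip_weight x false (nseq (size l) false) l =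
  (l == nseq (size l) false)%:R.
Proof. by elim: l => //= -[] l IH. Qed.

Lemma parts_nseq n : parts (nseq n false) = [::].
Proof. by elim: n. Qed.

Definition cauchy_factor A y : R := \prod_(a <- A) ((1 + a * y) / (1 - a * y)).

Lemma cauchy_factor_ge0 A y : {in A, forall a, 0 <= a} -> 0 <= y ->
  {in A, forall a, a * y < 1} -> 0 <= cauchy_factor A y.
Proof.
move=> A_ge0 y_ge0 Ay_lt1; rewrite /cauchy_factor big_seq; apply: prodr_ge0 => a aA.
apply: divr_ge0; last by rewrite subr_ge0 ltW ?Ay_lt1.
by apply: addr_ge0 => //; apply: mulr_ge0 => //; apply: A_ge0.
Qed.

(** Induction on the alphabet: branching splits off one variable, and the skew
    Cauchy identity moves the strip of variable y past it, at the cost of the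
    factor (1 + x y) / (1 - x y). *)
Theorem pieri A y mu : {in A, forall a, 0 <= a} -> 0 <= y ->
  {in A, forall a, a * y < 1} -> SP mu ->
  has_sum (fun la => 2 ^- size la * pweight y la mu * schurQ la A)
          (cauchy_factor A y * (2 ^- size mu * schurQ mu A)).
Proof.
move=> + y_ge0; elim: A mu => [|x A IH] mu A_ge0 Ay_lt1 SPmu.
  apply: (@has_sum_eventually _ _ _ (head 0%N mu)).
    by move=> la SPla; rewrite !mulr_ge0 ?pweight_ge0 ?invr_ge0 ?exprn_ge0 ?schurQ_ge0.
  move=> n mun; rewrite /cauchy_factor big_nil mul1r /truncated_sum.
  rewrite (bigD1_seq (nseq n false)) ?uniq_bitseqs ?mem_bitseqs ?size_nseq //=.
  rewrite [X in _ + X]big1_seq ?addr0 => [|l /andP[nl]]; last first.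
    rewrite mem_bitseqs => /eqP sl.
    by rewrite schurQ_nil sl (negbTE nl) mulr0.
  have SP0 : SP [::] := SP_parts [::].
  rewrite schurQ_nil size_nseq eqxx mulr1 parts_nseq (@pweightE n) //.
  rewrite -[in schurQ mu _](bitsK SPmu (SP_le SPmu mun)) schurQ_nil size_bits.
  have -> : bits n [::] = nseq n false by elim: n {mun} => //= n ->.
  rewrite -[in X in strip_weight _ _ (nseq X _)](size_bits n mu) weight_empty size_bits expr0 invr1 mul1r.
  case: eqP => [e|_]; last by rewrite mulr0.
  by rewrite -(nparts_bits SPmu mun) e /nparts parts_nseq expr0 invr1 mul1r.
have x_ge0 : 0 <= x by rewrite A_ge0 ?mem_head.
have xy_lt1 : x * y < 1 by rewrite Ay_lt1 ?mem_head.
have {}A_ge0 : {in A, forall a, 0 <= a} by move=> a aA; rewrite A_ge0 // inE aA orbT.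
have {}Ay_lt1 : {in A, forall a, a * y < 1} by move=> a aA; rewrite Ay_lt1 // inE aA orbT.
set c := (1 + x * y) / (1 - x * y).
have c_ge0 : 0 <= c.
  by apply: divr_ge0; [apply: addr_ge0 => //; apply: mulr_ge0 | rewrite subr_ge0 ltW].
have factorS : cauchy_factor (x :: A) y = c * cauchy_factor A y.
  by rewrite /cauchy_factor big_cons.
have upsum nu (SPnu : SP nu) :
    has_sum (fun la => 2 ^- size la * pweight y la mu * pweight x la nu)
            (c * skew_cauchy_dual x y mu nu) by apply: has_sum_up.
clearbody c; rewrite {}factorS.
have pow_neq0 n : 2 ^+ n != 0 :> R by rewrite expf_neq0.
(* Summed over nu first, F gives the left-hand side; summed over la first, the
   skew Cauchy identity turns it into h, which G expands over ka. *)
pose F la nu : R := 2 ^- size la * pweight y la mu * (pweight x la nu * schurQ nu A).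
pose G nu ka : R := c * (2 ^- size mu * 2 ^- size nu * 2 ^+ size ka *
   pweight x mu ka * pweight y nu ka) * schurQ nu A.
pose h nu : R := schurQ nu A * (c * skew_cauchy_dual x y mu nu).
have h_sum : has_sum h (c * cauchy_factor A y * (2 ^- size mu * schurQ mu (x :: A))).
  apply: (@has_sum_swap _ (fun ka nu => G nu ka)
     (fun ka => c * cauchy_factor A y * 2 ^- size mu * (pweight x mu ka * schurQ ka A))).
  - by move=> ka nu SPka SPnu; rewrite /G !mulr_ge0 ?pweight_ge0 ?schurQ_ge0 ?invr_ge0 ?exprn_ge0.
  - move=> ka SPka; have := IH ka A_ge0 Ay_lt1 SPka.
    move=> /(@has_sumZ _ (c * 2 ^- size mu * 2 ^+ size ka * pweight x mu ka)) => IHka.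
    rewrite (_ : _ * (pweight x mu ka * _) =
      c * 2 ^- size mu * 2 ^+ size ka * pweight x mu ka *
      (cauchy_factor A y * (2 ^- size ka * schurQ ka A))).
      apply: eq_has_sum (IHka _ _).
      + by move=> nu _; rewrite /G; ring.
      + by rewrite !mulr_ge0 ?pweight_ge0 ?invr_ge0 ?exprn_ge0.
      by move=> nu SPnu; rewrite !mulr_ge0 ?pweight_ge0 ?schurQ_ge0 ?invr_ge0 ?exprn_ge0.
    by field; rewrite !pow_neq0.
  - move=> nu SPnu; rewrite /h mulrA; apply: eq_has_sum (@has_sumZ _ (schurQ nu A * c) _ _ _ _
      (has_sum_down x_ge0 y_ge0 SPmu SPnu)) => [ka _||ka SPka].
    + by rewrite /G; ring.
    + by rewrite mulr_ge0 ?schurQ_ge0.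
    by rewrite !mulr_ge0 ?pweight_ge0 ?invr_ge0 ?exprn_ge0.
  rewrite mulrA; apply: has_sumZ (has_sum_branch x_ge0 A_ge0 SPmu).
    by rewrite mulr_ge0 ?invr_ge0 ?exprn_ge0 // mulr_ge0 ?cauchy_factor_ge0.
  by move=> ka SPka; rewrite mulr_ge0 ?pweight_ge0 ?schurQ_ge0.
apply: (@has_sum_swap _ (fun nu la => F la nu) h _ _ _ _ _ h_sum).
- by move=> nu la SPnu SPla; rewrite /F !mulr_ge0 ?pweight_ge0 ?schurQ_ge0 ?invr_ge0 ?exprn_ge0.
- move=> nu SPnu; apply: eq_has_sum (@has_sumZ _ (schurQ nu A) _ _ _ _
    (upsum nu SPnu)) => [la _||la SPla].
  + by rewrite /F; ring.
  + by rewrite schurQ_ge0.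
  by rewrite !mulr_ge0 ?pweight_ge0 ?invr_ge0 ?exprn_ge0.
move=> la SPla; apply: has_sumZ (has_sum_branch x_ge0 A_ge0 SPla).
  by rewrite !mulr_ge0 ?pweight_ge0 ?invr_ge0 ?exprn_ge0.
by move=> nu SPnu; rewrite mulr_ge0 ?pweight_ge0 ?schurQ_ge0.
Qed.

Lemma schurQ_empty A : schurQ [::] A = 1.
Proof. by rewrite schurQE. Qed.

(** Induction on [Y]: branching splits off one variable y, and the Pieri rule
    sums over the larger partition. *)
Theorem cauchy_identity A Y : {in A, forall a, 0 <= a} -> {in Y, forall y, 0 <= y} ->
  (forall a y, a \in A -> y \in Y -> a * y < 1) ->
  has_sum (fun la => schurQ la A * schurP la Y) (\prod_(y <- Y) cauchy_factor A y).
Proof.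
move=> A_ge0; elim: Y => [|y Y IH] Y_ge0 AY_lt1.
  apply: (@has_sum_eventually _ _ _ 0%N) => [la SPla|n _].
    by rewrite /schurP !mulr_ge0 ?schurQ_ge0 ?invr_ge0 ?exprn_ge0.
  rewrite big_nil /truncated_sum.
  rewrite (bigD1_seq (nseq n false)) ?uniq_bitseqs ?mem_bitseqs ?size_nseq //=.
  rewrite [X in _ + X]big1_seq ?addr0 => [|l /andP[nl]]; last first.
    rewrite mem_bitseqs => /eqP sl.
    by rewrite /schurP schurQ_nil sl (negbTE nl) !mulr0.
  by rewrite /schurP schurQ_nil size_nseq eqxx parts_nseq schurQ_empty expr0 invr1 !mulr1.
have y_ge0 : 0 <= y by rewrite Y_ge0 ?mem_head.
have Ay_lt1 : {in A, forall a, a * y < 1} by move=> a aA; rewrite AY_lt1 ?mem_head.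
have {}Y_ge0 : {in Y, forall y, 0 <= y} by move=> z zY; rewrite Y_ge0 // inE zY orbT.
have {}AY_lt1 a z : a \in A -> z \in Y -> a * z < 1.
  by move=> aA zY; rewrite AY_lt1 // inE zY orbT.
have {}IH := IH Y_ge0 AY_lt1.
have P_ge0 la Z : SP la -> {in Z, forall y, 0 <= y} -> 0 <= schurP la Z.
  by move=> ? ?; rewrite /schurP mulr_ge0 ?invr_ge0 ?exprn_ge0 ?schurQ_ge0.
rewrite big_cons.
apply: (@has_sum_swap _ (fun mu la =>
    schurQ la A * 2 ^- size la * (pweight y la mu * schurQ mu Y))
  (fun mu => cauchy_factor A y * (schurQ mu A * schurP mu Y))).
- by move=> mu la SPmu SPla; rewrite !mulr_ge0 ?pweight_ge0 ?schurQ_ge0 ?invr_ge0 ?exprn_ge0.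
- move=> mu SPmu.
  have := @has_sumZ _ (schurQ mu Y) _ _ _ _ (pieri A_ge0 y_ge0 Ay_lt1 SPmu).
  rewrite (_ : _ * (_ * _) = cauchy_factor A y * (schurQ mu A * schurP mu Y)); last first.
    by rewrite /schurP; ring.
  move=> H; apply: eq_has_sum (H _ _) => [la _||la SPla].
  + by ring.
  + exact: schurQ_ge0.
  by rewrite !mulr_ge0 ?pweight_ge0 ?schurQ_ge0 ?invr_ge0 ?exprn_ge0.
- move=> la SPla; rewrite /schurP mulrA.
  apply: has_sumZ (has_sum_branch y_ge0 Y_ge0 SPla).
    by rewrite !mulr_ge0 ?schurQ_ge0 ?invr_ge0 ?exprn_ge0.
  by move=> nu SPnu; rewrite mulr_ge0 ?pweight_ge0 ?schurQ_ge0.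
apply: has_sumZ IH; first exact: cauchy_factor_ge0.
by move=> la SPla; rewrite mulr_ge0 ?schurQ_ge0 ?P_ge0.
Qed.

End Cauchy.

(** * The exponential form of the Cauchy kernel *)

Section CauchyKernelExp.
Variable R : realType.
Implicit Types (s t : R) (A B : seq R).

Definition odd_sum (F : nat -> R) (N : nat) : R := \sum_(1 <= n < N | odd n) F n.

(** Only the odd indices below N occur, which is why the exponent is N rounded
    down to an even number. *)
Lemma odd_geometric s N :
  (1 - s ^+ 2) * odd_sum (fun n => s ^+ n.-1) N = 1 - s ^+ N./2.*2.
Proof.
elim: N => [|[|N] IH]; try by rewrite /odd_sum big_geq // mulr0 subrr.
rewrite /odd_sum big_mkcond big_nat_recr //= -big_mkcond mulrDr IH.
case: (boolP (odd N)) => /= oN.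
  by rewrite mulr0 addr0 uphalf_half oN.
rewrite uphalf_half (negbTE oN) add0n doubleS.
have -> : N = N./2.*2 by rewrite -[LHS]odd_double_half (negbTE oN).
by rewrite doubleK !exprS; ring.
Qed.

Definition atanh_poly N : {poly R} := \sum_(1 <= n < N | odd n) n%:R^-1 *: 'X^n.

Lemma horner_atanh_poly N t : (atanh_poly N).[t] = odd_sum (fun n => t ^+ n / n%:R) N.
Proof.
rewrite /atanh_poly horner_sum; apply: eq_bigr => n _.
by rewrite hornerZ hornerXn mulrC.
Qed.

Lemma deriv_atanh_poly N t :
  (atanh_poly N)^`().[t] = odd_sum (fun n => t ^+ n.-1) N.
Proof.
rewrite /atanh_poly raddf_sum horner_sum; apply: eq_bigr => n on.
rewrite /= derivZ derivXn hornerZ hornerMn hornerXn -[X in _ * X]mulr_natl mulrA mulVf ?mul1r //.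
by rewrite pnatr_eq0; case: n on.
Qed.

(** The derivative of the difference is an explicit geometric remainder, so
    the mean value theorem bounds the difference. *)
Lemma atanh_remainder t N : 0 <= t -> t < 1 ->
  0 <= ln ((1 + t) / (1 - t)) - 2 * odd_sum (fun n => t ^+ n / n%:R) N
    <= 2 / (1 - t ^+ 2) * t ^+ N.
Proof.
move=> t_ge0 t_lt1.
pose f : R -> R := (@ln R \o horner (1 + 'X)) - (@ln R \o horner (1 - 'X))
  - horner (2 *: atanh_poly N).
pose df s := 2 * s ^+ N./2.*2 / (1 - s ^+ 2).
have hp s : (1 + 'X : {poly R}).[s] = 1 + s by rewrite hornerD hornerX hornerC.
have hm s : (1 - 'X : {poly R}).[s] = 1 - s by rewrite hornerD hornerN hornerX hornerC.
have fdf s : 0 <= s -> s < 1 -> is_derive s 1 f (df s).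
  move=> s_ge0 s_lt1.
  have dp : is_derive (horner (1 + 'X) s) 1 (@ln R) (1 + s)^-1.
    by rewrite -hp; apply: is_derive1_ln; rewrite hp ltr_wpDr.
  have dm : is_derive (horner (1 - 'X) s) 1 (@ln R) (1 - s)^-1.
    by rewrite -hm; apply: is_derive1_ln; rewrite hm subr_gt0.
  have p_neq0 : 1 + s != 0 by rewrite gt_eqF // ltr_wpDr.
  have m_neq0 : 1 - s != 0 by rewrite gt_eqF // subr_gt0.
  apply: is_derive_eq.
  have e := odd_geometric s N.
  rewrite derivZ hornerZ deriv_atanh_poly.
  have -> : (1 + 'X : {poly R})^`() = 1 by rewrite derivD derivX derivC add0r.
  have -> : (1 - 'X : {poly R})^`() = -1 by rewrite derivB derivX derivC sub0r.
  rewrite hornerN !hornerC.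
  rewrite /df -[s ^+ N./2.*2](subKr 1) -e.
  have -> : 1 - s ^+ 2 = (1 + s) * (1 - s) by ring.
  by field; rewrite m_neq0 p_neq0.
have [||c] := @MVT_segment R f df 0 t t_ge0; last rewrite in_itv /= => /andP[c0 ct] e.
- move=> s; rewrite in_itv /= => /andP[/ltW s0 /lt_trans st].
  by apply: fdf => //; apply: st.
- apply: derivable_within_continuous => s; rewrite in_itv /= => /andP[s0 st].
  have [] := fdf s s0 (le_lt_trans st t_lt1); exact.
have ft : f t - f 0 = ln ((1 + t) / (1 - t)) - 2 * odd_sum (fun n => t ^+ n / n%:R) N.
  have fE s : f s = ln (1 + s) - ln (1 - s) - 2 * odd_sum (fun n => s ^+ n / n%:R) N.
    by rewrite -horner_atanh_poly -hornerZ -hp -hm.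
  have f0 : odd_sum (fun n => (0 : R) ^+ n / n%:R) N = 0.
    rewrite /odd_sum big1 // => n on; rewrite expr0n.
    by case: n on => // n _; rewrite mul0r.
  rewrite !fE f0 addr0 subr0 ln1 subrr mulr0 !subr0 ln_div // posrE.
    by rewrite ltr_wpDr.
  by rewrite subr_gt0.
rewrite -ft e subr0.
have c2 : 0 < 1 - c ^+ 2 by rewrite subr_gt0 expr_lt1 // (le_lt_trans ct).
have t2 : 0 < 1 - t ^+ 2 by rewrite subr_gt0 expr_lt1.
apply/andP; split.
  by rewrite /df !mulr_ge0 ?invr_ge0 ?exprn_ge0 // ltW.
rewrite /df -!mulrA ler_pM2l // mulrCA.
have c2' := ltW c2; apply: ler_pM; rewrite ?mulr_ge0 ?invr_ge0 ?exprn_ge0 //.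
  by rewrite lef_pV2 ?posrE // lerD2l lerN2 lerXn2r.
apply: (@le_trans _ _ (t ^+ N./2.*2.+1)).
  by rewrite exprSr ler_wpM2r // lerXn2r.
apply: ler_wiXn2l => //; first exact: ltW.
by rewrite -{1}[N]odd_double_half; case: (odd N).
Qed.

Lemma cvg_odd_sum t : 0 <= t -> t < 1 ->
  (odd_sum (fun n => t ^+ n / n%:R) N @[N --> \oo] -->
     ln ((1 + t) / (1 - t)) / 2)%classic.
Proof.
move=> t_ge0 t_lt1; set L := ln _.
have up : ((L - 2 / (1 - t ^+ 2) * t ^+ N) / 2 @[N --> \oo] --> L / 2)%classic.
  rewrite -[in X in (_ --> X)%classic](subr0 L).
  rewrite -[in X in (_ --> X)%classic](mulr0 (2 / (1 - t ^+ 2))).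
  apply: cvgM; last exact: cvg_cst.
  apply: cvgB; first exact: cvg_cst.
  by apply: (cvgM (cvg_cst _)); apply: cvg_expr; rewrite ger0_norm.
apply: squeeze_cvgr up (cvg_cst _); apply: nearW => N.
have := atanh_remainder N t_ge0 t_lt1; rewrite -/L => /andP[lo hi].
by apply/andP; split; lra.
Qed.

Lemma cvg_sum_seq (I : eqType) (s : seq I) (u : I -> nat -> R) (l : I -> R) :
  {in s, forall i, (u i @ \oo --> l i)%classic} ->
  (\sum_(i <- s) u i N @[N --> \oo] --> \sum_(i <- s) l i)%classic.
Proof.
elim: s => [|i s IH] ul.
  by under eq_fun do rewrite big_nil; rewrite big_nil; apply: cvg_cst.
under eq_fun do rewrite big_cons; rewrite big_cons.
apply: cvgD; first by apply: ul; apply: mem_head.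
by apply: IH => j js; apply: ul; rewrite inE js orbT.
Qed.

(** The double sum over the alphabets exchanges with the limit, and each pair
    of letters contributes the series of ln ((1 + a b) / (1 - a b)). *)
Lemma H_cauchy_factor A B :
  {in A, forall a, 0 <= a} -> {in B, forall b, 0 <= b} ->
  (forall a b, a \in A -> b \in B -> a * b < 1) ->
  H A B = \prod_(b <- B) cauchy_factor A b.
Proof.
move=> A_ge0 B_ge0 AB_lt1; rewrite /H.
pose L a b : R := ln ((1 + a * b) / (1 - a * b)) / 2.
have sumE N : \sum_(1 <= n < N | odd n) psum n A * psum n B / n%:R =
    \sum_(b <- B) \sum_(a <- A) odd_sum (fun n => (a * b) ^+ n / n%:R) N.
  rewrite /odd_sum; under [RHS]eq_bigr do rewrite exchange_big.
  rewrite exchange_big /=; apply: eq_bigr => n _.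
  rewrite /psum mulr_sumr mulr_suml; apply: eq_bigr => b _.
  rewrite !mulr_suml; apply: eq_bigr => a _; by rewrite exprMn.
have -> : limn (fun N => \sum_(1 <= n < N | odd n) psum n A * psum n B / n%:R) =
    \sum_(b <- B) \sum_(a <- A) L a b.
  apply: (cvg_lim (@Rhausdorff R)).
  under eq_fun do rewrite sumE.
  apply: cvg_sum_seq => b bB; apply: cvg_sum_seq => a aA.
  by apply: cvg_odd_sum; [apply: mulr_ge0; [apply: A_ge0 | apply: B_ge0] | apply: AB_lt1].
rewrite mulr_sumr expR_sum; apply: eq_big_seq => b bB.
rewrite /cauchy_factor mulr_sumr expR_sum; apply: eq_big_seq => a aA.
have ab0 : 0 <= a * b by apply: mulr_ge0; [apply: A_ge0 | apply: B_ge0].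
have ab1 : a * b < 1 by apply: AB_lt1.
rewrite /L mulrC divfK // lnK // posrE divr_gt0 //.
  by rewrite ltr_wpDr.
by rewrite subr_gt0 AB_lt1.
Qed.

End CauchyKernelExp.

(** * The normalizing constant *)

Lemma finite_subpart la : SP la ->
  finite_set (SP `&` [set mu | subpart mu la])%classic.
Proof.
move=> SPla; apply: (@sub_finite_set _ _ [set` map parts (bitseqs (head 0%N la))]%classic).
  move=> mu /(subpart_SP_le SPla)[SPmu mun] /=.
  by apply/mapP; exists (bits (head 0%N la) mu); rewrite ?bitsK // mem_bitseqs size_bits.
exact: finite_seq.
Qed.

(** For fixed la the finite sum over mu is the defining expansion of
    Q_la(X + qX); nonnegativity of all terms justifies summing over mu
    first. *)
Lemma Z_cauchy (R : realType) (q : R) (X Y : seq R) :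
  0 <= q -> {in X, forall x, 0 <= x} -> {in Y, forall y, 0 <= y} ->
  Z q X Y = (\esum_(la in SP) (schurQ la (X ++ scale q X) * schurP la Y)%:E)%E.
Proof.
move=> q_ge0 X_ge0 Y_ge0.
have qX_ge0 : {in scale q X, forall x, 0 <= x}.
  by move=> _ /mapP[x xX ->]; apply: mulr_ge0 => //; apply: X_ge0.
pose D la := (SP `&` [set mu | subpart mu la])%classic.
pose w la mu : R := schurQ mu (scale q X) * skewQ la mu X * schurP la Y.
have w_ge0 la mu : SP la -> D la mu -> 0 <= w la mu.
  move=> SPla [SPmu sub]; rewrite /w /schurP.
  by rewrite !mulr_ge0 ?schurQ_ge0 ?skewQ_ge0 ?invr_ge0 ?exprn_ge0.
transitivity (\esum_(la in SP) \esum_(mu in D la) (w la mu)%:E)%E.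
  rewrite esum_esum => [|la mu SPla Dmu]; last by rewrite lee_fin w_ge0.
  rewrite /Z (reindex_esum (SP `*`` D)%classic _ (fun p => (p.2, p.1))) //; split => //=.
  - by move=> [la mu] [/= SPla [SPmu sub]].
  - by move=> [? ?] [? ?] _ _ [-> ->].
  by move=> [mu la] [/= SPmu SPla sub]; exists (la, mu).
apply: eq_esum => la SPla; have finD := finite_subpart SPla.
rewrite esum_fset // => [|mu]; last by rewrite inE => Dmu; rewrite lee_fin w_ge0.
rewrite fsumEFin // skewQ_is_skewQ // mulrC mulr_fsumr //; congr (_%:E).
by apply: eq_fsbigr => mu _; rewrite /w; ring.
Qed.

Theorem theorem4p2 (R : realType) (q : R) (X Y : seq R)
    (q_ge0 : 0 <= q)
    (X_ge0 : forall x, x \in X -> 0 <= x)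
    (Y_ge0 : forall y, y \in Y -> 0 <= y)
    (XY_lt1 : forall x y, x \in X -> y \in Y -> Num.max 1 q * x * y < 1) :
  [/\ Z q X Y = (H (scale q X) Y * H X Y)%:E,
      H (scale q X) Y * H X Y = H (X ++ scale q X) Y
    & Z q X Y = (\prod_(x <- X) \prod_(y <- Y)
        ((1 + x * y) / (1 - x * y) *
         ((1 + q * x * y) / (1 - q * x * y))))%:E].
Proof.
have qX_ge0 : {in scale q X, forall x, 0 <= x}.
  by move=> _ /mapP[x xX ->]; apply: mulr_ge0 => //; apply: X_ge0.
have XqX_ge0 : {in X ++ scale q X, forall x, 0 <= x}.
  by move=> x; rewrite mem_cat => /orP[/X_ge0 | /qX_ge0].
have scaled_lt1 c x y : c <= Num.max 1 q -> x \in X -> y \in Y -> c * x * y < 1.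
  move=> cq xX yY; apply: le_lt_trans (XY_lt1 x y xX yY).
  rewrite -!mulrA; apply: ler_wpM2r => //.
  by apply: mulr_ge0; [apply: X_ge0 | apply: Y_ge0].
have X_lt1 x y : x \in X -> y \in Y -> x * y < 1.
  by move=> xX yY; rewrite -[x]mul1r scaled_lt1 // le_max lexx.
have qX_lt1 x y : x \in scale q X -> y \in Y -> x * y < 1.
  by move=> /mapP[z zX ->] yY; rewrite scaled_lt1 // le_max lexx orbT.
have XqX_lt1 x y : x \in X ++ scale q X -> y \in Y -> x * y < 1.
  by rewrite mem_cat => /orP[/X_lt1 | /qX_lt1]; apply.
have HE : H (scale q X) Y * H X Y = H (X ++ scale q X) Y.
  rewrite !H_cauchy_factor // -big_split; apply: eq_bigr => y _.
  by rewrite /cauchy_factor big_cat /= mulrC.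
have ZE : Z q X Y = (H (X ++ scale q X) Y)%:E.
  by rewrite Z_cauchy // (cauchy_identity XqX_ge0 Y_ge0 XqX_lt1) H_cauchy_factor.
split=> //; first by rewrite ZE HE.
rewrite ZE H_cauchy_factor //; congr (_%:E).
rewrite [RHS]exchange_big; apply: eq_bigr => y _.
by rewrite /cauchy_factor big_cat big_map [RHS]big_split.
Qed.
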